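(* Let $X$ be an infinite set of cardinality $\kappa$. Then: (i) for every cardinal $\lambda$ with $1\leq\lambda\leq 2^\kappa$ there exists a monoidal interval in the clone lattice over $X$ of cardinality $\lambda$; (ii) for every cardinal $\lambda\leq 2^\kappa$ there exists a monoidal interval in the clone lattice over $X$ of cardinality $2^\lambda$.
   Context: For $n\ge 1$, $\mathcal{O}^{(n)}$ is the set of all $n$-ary operations $X^n\to X$, and $\mathcal{O}=\bigcup_{n\geq 1}\mathcal{O}^{(n)}$. A clone on $X$ is a set $\mathcal{C}\subseteq\mathcal{O}$ closed under composition and containing all projections $\pi^n_k(x_1,\ldots,x_n)=x_k$ ($1\le k\le n$). The clone lattice $Cl(X)$ is the set of all clones on $X$ ordered by inclusion. For a submonoid $\mathcal{G}$ of $\mathcal{O}^{(1)}$ (under composition, containing the identity), the monoidal interval $\mathcal{I}_{\mathcal{G}}$ is the set of all clones $\mathcal{C}$ on $X$ with $\mathcal{C}\cap\mathcal{O}^{(1)}=\mathcal{G}$, ordered by inclusion. A monoidal interval is an interval of the form $\mathcal{I}_{\mathcal{G}}$. *)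

(* Defs.v *)
From mathcomp Require Import all_boot.
From mathcomp Require Import boolp classical_sets functions cardinality.

Set Implicit Arguments.
Unset Strict Implicit.
Unset Printing Implicit Defensive.

Local Open Scope classical_set_scope.

(* Operations of arity [n]; the n-tuple (x_1, ..., x_n) is a function on ['I_n]. *)
Definition operation (X : Type) (n : nat) : Type := ('I_n -> X) -> X.

(* Operations of arity at least 1: the index [n] stands for the arity [n.+1]. *)
Definition operations (X : Type) : Type := {n : nat & operation X n.+1}.

Definition op (X : Type) (n : nat) (f : operation X n.+1) : operations X :=
  existT (fun n => operation X n.+1) n f.

Definition proj (X : Type) (n : nat) (k : 'I_n) : operation X n :=
  fun x => x k.

Definition comp_op (X : Type) (n m : nat) (f : operation X n)
    (g : 'I_n -> operation X m) : operation X m :=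
  fun x => f (fun i => g i x).

Definition is_clone (X : Type) (C : set (operations X)) : Prop :=
  (forall (n : nat) (k : 'I_n.+1), C (op (@proj X n.+1 k))) /\
  (forall (n m : nat) (f : operation X n.+1) (g : 'I_n.+1 -> operation X m.+1),
     C (op f) -> (forall i, C (op (g i))) -> C (op (comp_op f g))).

Definition clone_lattice (X : Type) : set (set (operations X)) :=
  [set C | is_clone C].

(* Identifies O^(1) with X -> X, through the bijection X^1 = X. *)
Definition unary_op (X : Type) (f : X -> X) : operation X 1 :=
  fun x => f (x ord0).

Definition is_submonoid (X : Type) (G : set (X -> X)) : Prop :=
  G id /\ (forall f g : X -> X, G f -> G g -> G (f \o g)).

Definition unary_part (X : Type) (C : set (operations X)) : set (X -> X) :=
  [set f | C (op (unary_op f))].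

Definition interval_over (X : Type) (G : set (X -> X)) :
    set (set (operations X)) :=
  [set C | @clone_lattice X C /\ unary_part C = G].

Definition is_monoidal_interval (X : Type) (I : set (set (operations X))) : Prop :=
  exists2 G : set (X -> X), is_submonoid G & I = interval_over G.

(* Main.v *)
Require Import Defs.
From mathcomp Require Import all_boot.
From mathcomp Require Import boolp classical_sets functions cardinality.
From mathcomp Require Import wochoice.

Set Implicit Arguments.
Unset Strict Implicit.
Unset Printing Implicit Defensive.

Local Open Scope classical_set_scope.
Local Open Scope card_scope.

(** Up to a bijection, X consists of a point 0 and two copies (blocks) of an
infinite set W; this is the type [blocks W], with 0 as [None].  Let F be a
monoid of maps W -> W and N a set of further maps W -> W, containing the
constants, such that N is an ideal of the monoid formed by F and N.  The monoid
[unary_monoid F N] consists of the constants of X, the maps fixing 0 that act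
on both blocks by the same element of F and possibly exchange them, and the
maps sending one block to a block by an element of N and everything else to 0.

When F fixes two points r, r' of W and the non-constant elements of N are rigid
(they take prescribed values s and s' at r and r' and nowhere else,
[rigid_system]), the clones with this unary part are completely understood.
An operation preserving the monoid ([Pol]) has a normal form
([Pol_normal_form]): it is constant, or it is a map of the second kind applied
to one variable, or it is a [box], which applies some g in N to one variable if
certain variables lie in prescribed blocks and is 0 otherwise.  This comes from
looking at a nonzero value whose argument has as few nonzero entries as
possible: the lines through it show that the operation lives on a box
([support_box]), and rigidity makes an operation on W whose lines all lie in N
essentially unary ([collapse]).  A box with at least two conditions generates
the binary box [wide g], and conversely [wide g] generates all boxes of g.
Hence a clone C of the interval is determined by the set of all g in N with
[wide g] in C, and the sets that occur are precisely the ideals of F and N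
contained in N, the empty set included ([interval_ideals], [clone_of_inj]).
The cardinality of the interval is thus the number of these ideals.

It remains to find F and N with a prescribed number of ideals.  Let L be a
preordered set with an injection into the subsets of X; reading subsets as
words over the index set X turns the elements of L into 0-1-words.  N consists
of the constants and of maps [gam u], where u is the word of an element of L or
a junk word, that is, a word with an undefined letter.  F acts on words
letterwise; it can move the word of p to the word of q for q <= p while making
all other words junk, and it can move any word to any junk word.  The ideals
are then the empty set, the constants, and one ideal for each downset of L
([ideal_trichotomy]), so the interval has two more elements than L has downsets
([downset_interval]).

A well-order has one more downset than it has elements, so a set with at least
three elements, deprived of three of them and well-ordered, gives an interval of
the cardinality of that set.  Intervals with one and two elements are obtained
from the monoid of the identity and the constants of X ([collapsing_interval])
and from F = {id}, N = constants ([trivial_interval]).  In an antichain all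
subsets are downsets, which gives the cardinality 2^lambda for infinite lambda;
for finite lambda it is an instance of the first claim.  The cardinal arithmetic
rests on |X * nat| = |X| ([infinite_absorbs_nat]). *)

(** * Changing one coordinate of a tuple *)

Section Update.
Variables (n : nat) (T : Type).
Implicit Types (a b c : 'I_n -> T) (k : 'I_n).

Definition upd a k (x : T) : 'I_n -> T := fun j => if j == k then x else a j.

Lemma updE a k x : upd a k x k = x.
Proof. by rewrite /upd eqxx. Qed.

Lemma updN a k x j : j != k -> upd a k x j = a j.
Proof. by rewrite /upd => /negbTE->. Qed.

Lemma upd_id a k : upd a k (a k) = a.
Proof. by apply/funext => j; rewrite /upd; case: eqP => [->|]. Qed.

Lemma updC a k j x y : k != j -> upd (upd a k x) j y = upd (upd a j y) k x.
Proof.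
move=> kj; apply/funext => l; rewrite /upd.
by case: (eqVneq l j) => [->|//]; rewrite eq_sym (negbTE kj).
Qed.

(** What is known about the lines of an operation is turned into knowledge about
the operation by this induction. *)
Lemma upd_ind (P : ('I_n -> T) -> Prop) a b :
  P a -> (forall c k, P c -> P (upd c k (b k))) -> P b.
Proof.
move=> Pa Pupd.
suff H m : P (fun j => if j < m then b j else a j).
  by have := H n; congr P; apply/funext => j; rewrite ltn_ord.
elim: m => [//|m IH]; have [mn|nm] := ltnP m n.
  have := Pupd _ (Ordinal mn) IH; congr P; apply/funext => j.
  have [->|jm] := eqVneq j (Ordinal mn); first by rewrite updE /= ltnSn.
  rewrite updN // ltnS (leq_eqVlt j) (_ : (j == m :> nat) = false) //.
  exact/negbTE.
move: IH; congr P; apply/funext => j.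
by rewrite ltnS (leq_trans (ltn_ord j) nm) ltnW ?(leq_trans (ltn_ord j) nm).
Qed.

End Update.

(** * Operations all of whose lines are constant or rigid *)

Definition rigid (W : Type) (r r' s s' : W) (f : W -> W) :=
  forall x, (f x = s <-> x = r) /\ (f x = s' <-> x = r').

Lemma rigidC W (r r' s s' : W) f : rigid r r' s s' f -> rigid r' r s' s f.
Proof. by move=> rf x; have [] := rf x. Qed.

Section RigidColumn.
Variables (W : Type) (N : set (W -> W)).
Implicit Types (f : W -> W -> W).

Let dichotomy r r' s s' :=
  forall g, N g -> (exists c, forall x, g x = c) \/ rigid r r' s s' g.

Lemma rigid_or_row r r' s s' f : dichotomy r r' s s' -> (forall x, N (f x)) ->
  forall x b, (forall y, f x y = f x b) \/ rigid r r' s s' (f x).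
Proof.
move=> dich Nrow x b; case: (dich _ (Nrow x)) => [[c fc]|]; last by right.
by left=> y; rewrite !fc.
Qed.

Lemma rigid_of_neq r r' s s' f y x x' : dichotomy r r' s s' ->
  (forall y, N (f^~ y)) -> f x y <> f x' y -> rigid r r' s s' (f^~ y).
Proof.
move=> dich Ncol xx'; case: (dich _ (Ncol y)) => // -[c fc].
by case: xx'; rewrite /= in fc; rewrite !fc.
Qed.

(** The row of a point [x <> r] is constant, since a rigid row would take the
value [s] at [r], where column [r] takes it only for [x = r].  Hence every column
has distinct values at [r'] and at a third point, so it is rigid as well, and
its value at [r] is forced to be [s]. *)
Lemma rigid_col_special r r' s s' f : dichotomy r r' s s' -> r <> r' ->
  (exists t, t <> r /\ t <> r') ->
  (forall y, N (f^~ y)) -> (forall x, N (f x)) -> rigid r r' s s' (f^~ r) ->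
  forall x y, f x y = f x r.
Proof.
move=> dich rr' [t [tr tr']] Ncol Nrow rr.
have rowP := rigid_or_row dich Nrow.
have rowx x y : x <> r -> f x y = f x r.
  move=> xr; case: (rowP x r) => [->//|rx]; case: xr.
  by apply/(proj1 (rr x)); apply/(proj1 (rx r)).
move=> x y; have [->|] := pselect (x = r); last exact: rowx.
have -> : f r r = s by apply/(proj1 (rr r)).
have /(_ r)[[_ H] _] : rigid r r' s s' (f^~ y); last exact: H.
apply: (rigid_of_neq (x := r') (x' := t) dich Ncol).
rewrite !rowx //; last by move=> E; apply: rr'.
have -> : f r' r = s' by apply/(proj2 (rr r')).
by move=> E; apply: tr'; apply/(proj2 (rr t)).
Qed.

Lemma rigid_col r r' s s' f b : dichotomy r r' s s' -> r <> r' ->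
  (exists t, t <> r /\ t <> r') ->
  (forall y, N (f^~ y)) -> (forall x, N (f x)) -> rigid r r' s s' (f^~ b) ->
  forall x y, f x y = f x b.
Proof.
move=> dich rr' third Ncol Nrow rb.
have dich' : dichotomy r' r s' s.
  by move=> g Ng; case: (dich g Ng) => [|rg]; [left|right; exact: rigidC].
have [Eb|br] := pselect (b = r).
  by rewrite Eb in rb *; exact: (rigid_col_special dich).
have [Eb|br'] := pselect (b = r').
  rewrite Eb in rb *; apply: (rigid_col_special dich') => //.
  - by move=> E; apply: rr'.
  - by have [t [tr tr']] := third; exists t.
  - exact: rigidC.
have ss' : s <> s'.
  move=> E; apply: rr'; apply/(proj2 (rb r)); rewrite -E.
  exact/(proj1 (rb r)).
have rowP := rigid_or_row dich Nrow.
(* the rows of [r] and [r'] are constant, so all columns are rigid *)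
have rowr y : f r y = s.
  have fr : f r b = s by apply/(proj1 (rb r)).
  by case: (rowP r b) => [->//|/(_ b)[[H _] _]]; case: br; exact: H.
have rowr' y : f r' y = s'.
  have fr' : f r' b = s' by apply/(proj2 (rb r')).
  by case: (rowP r' b) => [->//|/(_ b)[_ [H _]]]; case: br'; exact: H.
have col y : rigid r r' s s' (f^~ y).
  by apply: (rigid_of_neq (x := r) (x' := r') dich Ncol); rewrite rowr rowr'.
move=> x; case: (rowP x b) => // rx; case: rr'.
have <- : x = r by apply/(proj1 (col r x)); apply/(proj1 (rx r)).
by apply/(proj2 (col r' x)); apply/(proj2 (rx r')).
Qed.

End RigidColumn.

(** If some line is rigid, then changing any other coordinate does not change
that line, by [rigid_col] in the plane of the two coordinates. *)
Lemma collapse (W : Type) (N : set (W -> W)) (r r' s s' : W) :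
  (forall c, N (fun=> c)) ->
  (forall f, N f -> (exists c, forall x, f x = c) \/ rigid r r' s s' f) ->
  r <> r' -> (exists t, t <> r /\ t <> r') ->
  forall n (f : ('I_n.+1 -> W) -> W),
  (forall a k, N (fun x => f (upd a k x))) ->
  exists i, exists2 g, N g & forall v, f v = g (v i).
Proof.
move=> N_cst N_dich rr' third n f Nf.
have [[a [k rak]]|H] := pselect (exists a k, rigid r r' s s' (fun x => f (upd a k x))).
  exists k, (fun x => f (upd a k x)); first exact: Nf.
  suff H v x : f (upd v k x) = f (upd a k x).
    by move=> v; rewrite -[in LHS](upd_id v k) H.
  move: x; apply: (@upd_ind _ _ (fun c => forall x, _ = f (upd a k x)) a v) => //.
  move=> c j IHc x; rewrite -IHc; have [->|jk] := eqVneq j k.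
    by congr f; apply/funext => l; rewrite /upd; case: eqP.
  have kj : k != j by rewrite eq_sym.
  rewrite -[upd c k x](upd_id _ j) (updN _ _ jk) -(updC _ _ _ kj).
  apply: (@rigid_col _ N r r' s s' (fun x y => f (upd (upd c k x) j y)) (c j)) => //.
    move=> y; have := Nf (upd c j y) k; congr (N _); apply/funext => z.
    by rewrite updC.
  move: rak; congr (rigid _ _ _ _ _); apply/funext => z.
  by rewrite -IHc updC // upd_id.
exists ord0, (fun=> f (fun=> r)); first exact: N_cst.
move=> v; apply: (@upd_ind _ _ (fun c => f c = f (fun=> r)) (fun=> r) v) => //.
move=> c k <-; have [[x0 cx]|rg] := N_dich _ (Nf c k); last by case: H; exists c, k.
by rewrite cx -(cx (c k)) upd_id.
Qed.

(** * The unary monoid on a point and two blocks *)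

Definition constants (W : Type) : set (W -> W) :=
  [set f | exists c, f = (fun=> c)].
Arguments constants : clear implicits.

(** The elements of [F] are to be thought of as the units and those of [N] as
the non-units of a monoid of maps W -> W. *)
Record rigid_system (W : Type) (F N : set (W -> W)) (r r' s s' : W) : Prop := {
  sys_id : F id;
  sys_FF : forall f g, F f -> F g -> F (f \o g);
  sys_fix : forall f, F f -> f r = r /\ f r' = r';
  sys_cst : forall c, N (fun=> c);
  sys_FN : forall f g, F f -> N g -> N (f \o g);
  sys_NF : forall f g, N f -> F g -> N (f \o g);
  sys_NN : forall f g, N f -> N g -> N (f \o g);
  sys_rigid : forall f, N f ->
    (exists c, forall x, f x = c) \/ rigid r r' s s' f;
  sys_rr' : r <> r';
  sys_sr : s <> r;
  sys_third : exists t, t <> r /\ t <> r' }.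

Section Blocks.
Variables (W : Type) (F N : set (W -> W)) (r r' s s' : W).
Hypothesis sys : rigid_system F N r r' s s'.

Definition blocks : Type := option (bool * W).
Local Notation X := blocks.

Definition block_of (x : X) : option bool := omap fst x.

Definition full (b : bool) (g : W -> W) (x : X) : X :=
  omap (fun p => (p.1 (+) b, g p.2)) x.

Definition blk (i j : bool) (f : W -> W) (x : X) : X :=
  if x is Some (k, w) then if k == i then Some (j, f w) else None else None.

Inductive unary_monoid (h : X -> X) : Prop :=
| G_cst c of h =1 (fun=> c)
| G_full b g of F g & h =1 full b g
| G_blk i j f of N f & h =1 blk i j f.

Local Notation G := unary_monoid.

Lemma G_idfun : G id.
Proof.
apply: (@G_full _ false _ (sys_id sys)).
by case=> [[k w]|] //=; rewrite addbF.
Qed.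

Lemma G_comp h k : G h -> G k -> G (h \o k).
Proof.
move=> Gh [c Ek|b g Fg Ek|i j f Nf Ek].
- by apply: (@G_cst _ (h c)) => x; rewrite /= Ek.
- case: Gh => [c Eh|b' g' Fg' Eh|i j f Nf Eh].
  + by apply: (@G_cst _ c) => x; rewrite /= Eh.
  + apply: (@G_full _ (b (+) b') _ (sys_FF sys Fg' Fg)) => x.
    by rewrite /= Ek Eh; case: x => [[k0 w]|] //=; rewrite addbA.
  + apply: (@G_blk _ (i (+) b) j _ (sys_NF sys Nf Fg)) => x.
    rewrite /= Ek Eh; case: x => [[k0 w]|] //=.
    by case: i b k0 {Eh Ek} => [] [] [].
- case: Gh => [c Eh|b' g' Fg' Eh|i' j' f' Nf' Eh].
  + by apply: (@G_cst _ c) => x; rewrite /= Eh.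
  + apply: (@G_blk _ i (j (+) b') _ (sys_FN sys Fg' Nf)) => x.
    by rewrite /= Ek Eh; case: x => [[k0 w]|] //=; case: eqP.
  + have [E|E] := eqVneq j i'.
      apply: (@G_blk _ i j' _ (sys_NN sys Nf' Nf)) => x.
      rewrite /= Ek Eh; case: x => [[k0 w]|] //=.
      by case: eqP => //= _; rewrite E eqxx.
    apply: (@G_cst _ None) => x; rewrite /= Ek Eh; case: x => [[k0 w]|] //=.
    by case: eqP => //= _; rewrite (negbTE E).
Qed.

Lemma G_block_of h x y : G h ->
  block_of x = block_of y -> block_of (h x) = block_of (h y).
Proof.
case=> [c E|b g _ E|i j f _ E]; rewrite !E //;
  case: x y => [[k w]|] [[l v]|] //= [->] //.
by case: eqP.
Qed.

Lemma block_of0 x : (block_of x = None) <-> (x = None).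
Proof. by case: x => [[]|]. Qed.

(** Only constants move 0; this is used whenever a line is nonzero at 0. *)
Lemma G_nonzero_at0 h : G h -> h None <> None -> forall x, h x = h None.
Proof.
by case=> [c E|b g _ E|i j f _ E] h0 x; [rewrite !E|case: h0|case: h0].
Qed.

Lemma G_full_support h u v : G h -> h None = None ->
  h (Some (true, u)) <> None -> h (Some (false, v)) <> None ->
  exists b, exists2 g, F g & h =1 full b g.
Proof.
case=> [c E|b g Fg E|i j f _ E]; rewrite !E //; last by case: i {E}.
by move=> _ _ _; exists b, g.
Qed.

Lemma G_block_support h i u v : G h -> h None = None ->
  h (Some (i, u)) <> None -> h (Some (~~ i, v)) = None ->
  exists j, exists2 f, N f & h =1 blk i j f.
Proof.
case=> [c E|b g Fg E|i' j f Nf E]; rewrite !E /=; [|by []|].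
  by move=> -> /(_ erefl).
by case: eqP => [->|//] _ _ _; exists j, f.
Qed.

(** Together with 0, this sends a whole block to a prescribed point: the
substitutions by which values of an operation are read off. *)
Definition pt (i : bool) (a : X) : X -> X :=
  if a is Some (j, w) then blk i j (fun=> w) else fun=> None.

Lemma G_pt i a : G (pt i a).
Proof.
case: a => [[j w]|]; last exact: (@G_cst _ None).
exact: (@G_blk _ i j _ (sys_cst sys w)).
Qed.

Lemma pt0 i a : pt i a None = None. Proof. by case: a => [[]|]. Qed.

Lemma ptE i a w : pt i a (Some (i, w)) = a.
Proof. by case: a => [[j v]|] //=; rewrite eqxx. Qed.

Lemma ptN i a w : pt (~~ i) a (Some (i, w)) = None.
Proof. by case: a => [[j v]|] //=; case: i. Qed.

Lemma G_const c : G (fun=> c). Proof. exact: (@G_cst _ c). Qed.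

Lemma FN_disj f g : F g -> N f -> ~ f =1 g.
Proof.
move=> /(sys_fix sys)[gr gr'] /(sys_rigid sys)[[c fc]|rf] fg.
  by apply: (sys_rr' sys); rewrite -gr -gr' -!fg !fc.
apply: (sys_sr sys); rewrite -gr -fg; apply/esym.
exact/(proj1 (rf r)).
Qed.

(** * Operations preserving the unary monoid *)

Definition Pol n (f : operation X n) :=
  forall w : 'I_n -> X -> X, (forall k, G (w k)) ->
    G (fun x => f (fun k => w k x)).

Definition Pol2 (f : X -> X -> X) :=
  forall u v, G u -> G v -> G (fun x => f (u x) (v x)).

Lemma Pol2_sym f : Pol2 f -> Pol2 (fun x y => f y x).
Proof. by move=> Pf u v Gu Gv; exact: (Pf v u). Qed.

Lemma full_inj0 b g x : full b g x = None -> x = None.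
Proof. by case: x => [[]|]. Qed.

(** A line supported on both blocks determines the plane.  If [f x None = None]
for some [x] in a block, then substituting for [y] a map that is [y0] on the
other block and 0 elsewhere yields the given line cut down to that other block;
but no element of [F] lies in [N]. *)
Lemma full_line2 f y0 b g : Pol2 f -> F g -> (f^~ y0) =1 full b g ->
  forall x y, f x y = full b g x.
Proof.
move=> Pf Fg E.
have row x : G (f x) by exact: (Pf (fun=> x) id (G_const x) G_idfun).
have col y : G (f^~ y) by exact: (Pf id (fun=> y) G_idfun (G_const y)).
have nz x : x <> None -> f x None <> None.
  move=> x0; case: y0 E => [y0|E]; last by rewrite E => /full_inj0.
  case: x x0 => [[i w]|//] _ E fx0.
  have Gh : G (fun x => f x (pt (~~ i) (Some y0) x)).
    by apply: Pf; [exact: G_idfun|exact: G_pt].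
  case: Gh => [c Eh|b' g' _ Eh|i' j f' Nf' Eh].
  - have := Eh (Some (~~ i, w)); rewrite ptE E.
    have := Eh (Some (i, w)); rewrite ptN fx0 => <- //.
  - by have := Eh (Some (i, w)); rewrite ptN fx0.
  - have Ei' : i' = ~~ i.
      have := Eh (Some (~~ i, w)); rewrite ptE E /=; by case: eqP.
    apply: (FN_disj Fg Nf') => v.
    by have := Eh (Some (~~ i, v)); rewrite ptE E /= Ei' eqxx => -[].
have main x y : x <> None -> f x y = full b g x.
  move=> /nz x0; have H := G_nonzero_at0 (row x) x0.
  by rewrite (H y) -(H y0) E.
move=> x y; have [->|/main//] := pselect (x = None).
apply: contrapT => /(G_nonzero_at0 (col y)) => H.
have := H (Some (true, r)); rewrite -(H (Some (true, r'))) !main //= => -[].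
have [-> ->] := sys_fix sys Fg; exact: (sys_rr' sys).
Qed.

Section Nary.
Variables (n : nat) (f : operation X n).
Hypothesis Pf : Pol f.

Lemma Pol_line a k : G (fun x => f (upd a k x)).
Proof.
have := Pf (w := fun j => if j == k then id else fun=> a j).
have -> : (fun x => f (fun j => (if j == k then id else fun=> a j) x)) =
          (fun x => f (upd a k x)).
  by apply/funext => x; congr f; apply/funext => j; rewrite /upd; case: eqP.
by apply=> j; case: eqP => _; [exact: G_idfun|exact: G_const].
Qed.

Lemma Pol_subst2 (w : 'I_n -> X -> X) k : (forall k, G (w k)) ->
  Pol2 (fun x y => f (upd (fun j => w j y) k (w k x))).
Proof.
move=> Gw u v Gu Gv.
have := Pf (w := fun j => if j == k then w j \o u else w j \o v).
have -> : (fun x => f (fun j => (if j == k then w j \o u else w j \o v) x)) =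
          (fun x => f (upd (fun j => w j (v x)) k (w k (u x)))).
  apply/funext => x; congr f; apply/funext => j; rewrite /upd.
  by case: eqP => // ->.
by apply=> j; case: eqP => _; exact: G_comp.
Qed.

Lemma Pol_plane a k j : k != j -> Pol2 (fun x y => f (upd (upd a k x) j y)).
Proof.
move=> kj.
have := @Pol_subst2 (fun l => if (l == k) || (l == j) then id else fun=> a l) k.
have -> : (fun x y => f (upd (fun l => (if (l == k) || (l == j) then id
             else fun=> a l) y) k ((if (k == k) || (k == j) then id
             else fun=> a k) x))) = (fun x y => f (upd (upd a k x) j y)).
  apply/funext => x; apply/funext => y; congr f; apply/funext => l.
  rewrite /upd eqxx /=; case: (eqVneq l k) => [->|lk] /=.
    by rewrite (negbTE kj).
  by case: eqP.
by apply=> l; case: ifP => _; [exact: G_idfun|exact: G_const].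
Qed.

Lemma Pol_zero : f (fun=> None) <> None -> forall a, f a = f (fun=> None).
Proof.
move=> f0 a; have Gw k : G (pt true (a k)) by exact: G_pt.
have E0 : f (fun k => pt true (a k) None) = f (fun=> None).
  by congr f; apply/funext => k; rewrite pt0.
have := G_nonzero_at0 (Pf Gw); rewrite E0 => /(_ f0 (Some (true, r))) <-.
by congr f; apply/funext => k; rewrite ptE.
Qed.

Lemma full_line a k b g : F g -> (fun x => f (upd a k x)) =1 full b g ->
  forall c, f c = full b g (c k).
Proof.
move=> Fg E c.
suff H x : f (upd c k x) = full b g x by rewrite -[in LHS](upd_id c k) H.
move: x; apply: (@upd_ind _ _ (fun c => forall x, _ = full b g x) a c) => //.
move=> d j Ed x; have [->|jk] := eqVneq j k.
  by rewrite -Ed; congr f; apply/funext => l; rewrite /upd; case: eqP.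
have kj : k != j by rewrite eq_sym.
rewrite -(updC _ _ _ kj).
apply: (@full_line2 (fun x y => f (upd (upd d k x) j y)) (d j)) => //.
  exact: Pol_plane.
by move=> z /=; rewrite updC // upd_id.
Qed.

Lemma Pol_block_of a b : (forall k, block_of (a k) = block_of (b k)) ->
  block_of (f a) = block_of (f b).
Proof.
move=> ab.
pose P c := block_of (f a) = block_of (f c) /\
  forall k, block_of (c k) = block_of (b k).
suff [] : P b by [].
apply: (@upd_ind _ _ P a b); first by split.
move=> c k [fc cb]; split.
  rewrite fc -[in LHS](upd_id c k).
  exact: (G_block_of (Pol_line c k)).
by move=> j; rewrite /upd; case: eqP => // ->.
Qed.

End Nary.

(** Substituting such maps for the variables of an operation gives a unary map
that runs through the types of one tuple on the first block and through those of
another one on the second block.  The values at 0 are needed to get fewer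
nonzero entries there. *)
Lemma exists_switch s1 s2 : exists w, [/\ G w,
  forall u, block_of (w (Some (true, u))) = block_of s1,
  forall u, block_of (w (Some (false, u))) = block_of s2,
  s1 = None -> w None = None & block_of s1 <> block_of s2 -> w None = None].
Proof.
have [E|] := pselect (block_of s1 = block_of s2).
  by exists (fun=> s1); split=> //; exact: G_const.
case: s1 s2 => [[i x]|] [[j y]|] //= ij.
- exists (full (~~ i) id); split=> // [|u|u]; first exact: G_full (sys_id sys) _.
    by case: i {ij}.
  by case: i j ij => [] [].
- exists (pt true (Some (i, x))); split=> //; exact: G_pt.
- exists (pt false (Some (j, y))); split=> //; exact: G_pt.
Qed.

(** [c k] is the block prescribed for the variable [k], if there is any. *)
Definition box n (c : 'I_n -> option bool) (i : 'I_n) (j : bool) (g : W -> W) :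
    operation X n := fun x =>
  if [forall k, (c k == None) || (block_of (x k) == c k)]
  then (if x i is Some (_, w) then Some (j, g w) else None) else None.

Inductive normal_form n (f : operation X n) : Prop :=
| Normal_cst x of forall a, f a = x
| Normal_full k b g of F g & forall a, f a = full b g (a k)
| Normal_box c i j g of c i <> None & N g & forall a, f a = box c i j g a.

Section MinimalSupport.
Variables (n : nat) (f : operation X n) (a : 'I_n -> X).
Hypothesis Pf : Pol f.
Hypothesis nofull : forall c k b g, F g ->
  ~ (fun x => f (upd c k x)) =1 full b g.
Let supp (c : 'I_n -> X) := #|[pred k | block_of (c k) != None]|.
Hypothesis fa : f a <> None.
Hypothesis mina : forall c, supp c < supp a -> f c = None.

(** Suppose that [f b] is nonzero although [b k0] has the wrong type.  A
substitution [w] switching between [a] and [b] makes [f] a unary map [h]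
supported on both blocks (by minimality of [a] it vanishes at 0), so [h] acts
by an element of [F], which fixes [r] and [r'].  Separating the variable [k0]
from the others gives a binary operation [f2] with diagonal [h].  Let both
variables range over the first block.  The line [f2 x r] acts by an element of
[N] fixing [r]; since a non-constant one would send [r] to [s], it is constant
and takes the value [r] at [r'], too.  So the line [f2 r' y] fixes both [r'] and
[r].  No constant and no rigid map does so, and an element of [F] would make
[f2] a function of [y] by [full_line2], although [f2] vanishes at [x = 0]. *)
Lemma support_box b : f b <> None ->
  forall k, a k <> None -> block_of (b k) = block_of (a k).
Proof.
move=> fb k0 ak0; apply: contrapT => bk0.
have [w Pw] := choice (fun k => exists_switch (a k) (b k)).
have Gw k : G (w k) by case: (Pw k).
have wa u k : block_of (w k (Some (true, u))) = block_of (a k) by case: (Pw k).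
have wb u k : block_of (w k (Some (false, u))) = block_of (b k) by case: (Pw k).
have w0 : w k0 None = None by case: (Pw k0) => _ _ _ _; apply => E; apply: bk0.
pose h x := f (fun k => w k x).
have nz c d : (forall k, block_of (c k) = block_of (d k)) ->
    f d <> None -> f c <> None.
  by move=> cd fd /(block_of0 _)/=; rewrite (Pol_block_of Pf cd) => /block_of0.
(* nonzero entries only where [a] has them, and fewer of them *)
have small c : (forall k, block_of (c k) = None \/
      block_of (c k) = block_of (a k) \/ a k <> None) ->
    c k0 = None -> f c = None.
  move=> ca c0; apply: mina; apply: proper_card; apply/properP; split.
    apply/fintype.subsetP => k; rewrite !inE => /eqP ck; apply/eqP => ak.
    by case: (ca k) => [//|[|]]; [rewrite ak|case; apply/block_of0].
  by exists k0; rewrite !inE ?c0 //; apply/eqP => /block_of0.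
have Gh : G h by exact: Pf.
have h0 : h None = None.
  apply: small => // k; case: (Pw k) => _ _ _ H _.
  have [/H->|] := pselect (a k = None); [by left|by right; right].
have [||e [g Fg hg]] := @G_full_support h r r Gh h0.
- by apply: nz fa => k.
- by apply: nz fb => k.
have [gr gr'] := sys_fix sys Fg.
(* the variable [k0] is separated from the others *)
pose f2 x y := f (upd (fun j => w j y) k0 (w k0 x)).
have P2 : Pol2 f2 by exact: Pol_subst2.
have f2h x : f2 x x = h x by rewrite /f2 /h (upd_id (fun j => w j x)).
pose y0 : X := Some (true, r).
have f20 : f2 None y0 = None.
  apply: small; last by rewrite updE.
  move=> k; have [->|kk0] := eqVneq k k0; first by right; right.
  by rewrite updN //; right; left; exact: wa.
have f2f : f2 (Some (false, r)) y0 = None.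
  have Gl := Pol_line Pf (fun j => w j y0) k0.
  pose l x := f (upd (fun j => w j y0) k0 x).
  have l0 : l None = None by rewrite -[RHS]f20 /f2 w0.
  have la x : block_of x = block_of (a k0) -> l x <> None.
    move=> xa; apply: nz fa => k; have [->|kk0] := eqVneq k k0.
      by rewrite updE.
    by rewrite updN // wa.
  apply: contrapT => l1.
  have tb : block_of (w k0 (Some (false, r))) = block_of (b k0) by [].
  rewrite -/(l _) in l1.
  have : exists b, exists2 g, F g & l =1 full b g.
    move: l1 tb la bk0; rewrite /f2 -/(l _).
    case: (w k0 _) => [[i u]|] /=; last by rewrite l0.
    case: (a k0) ak0 => [[i' u']|//] _ l1 <- la ii'.
    have la' := la (Some (i', u')) erefl.
    by case: i i' ii' l1 la' {la} => [] [] // _ l1 la';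
      [exact: (G_full_support Gl l0 l1 la')|exact: (G_full_support Gl l0 la' l1)].
  by move=> [b' [g' Fg' lg]]; exact: (nofull Fg' lg).
have Gc : G (f2^~ y0) by exact: (P2 id (fun=> y0) G_idfun (G_const y0)).
have [|j [d Nd Ed]] := @G_block_support _ true r r Gc f20 _ f2f.
  by rewrite f2h hg.
have dr : d r = r.
  by have := Ed y0; rewrite f2h hg /= => -[_ <-].
have dr' : d r' = r.
  case: (sys_rigid sys Nd) => [[x dx]|rd]; first by rewrite dx -(dx r).
  by case: (sys_sr sys); rewrite -dr; apply/esym/(proj1 (rd r)).
pose z0 : X := Some (true, r').
have Gr : G (f2 z0) by exact: (P2 (fun=> z0) id (G_const z0) G_idfun).
have Ez : f2 z0 z0 = full e g z0 by rewrite f2h hg.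
have Ey : f2 z0 y0 = Some (j, r) by rewrite Ed /= dr'.
case: Gr => [x Ex|b' g' Fg' Eg|i' j' d' Nd' Ed'].
- move: Ez Ey; rewrite !Ex => -> /= -[_].
  by rewrite gr' => E; apply: (sys_rr' sys).
- have := @full_line2 _ z0 b' g' (Pol2_sym P2) Fg' Eg y0 None.
  by rewrite f20.
- case: (eqVneq true i') => [E|E]; last first.
    by move: Ez; rewrite Ed' /= (negbTE E).
  move: Ez Ey; rewrite !Ed' /= E eqxx /= gr' => -[_ d'r'] [_ d'r].
  case: (sys_rigid sys Nd') => [[x dx]|rd].
    by apply: (sys_rr' sys); rewrite -d'r -d'r' !dx.
  by case: (sys_sr sys); rewrite -d'r; apply/esym/(proj1 (rd r)).
Qed.

End MinimalSupport.
End Blocks.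

(** * Normal forms *)

Section NormalForms.
Variables (W : Type) (F N : set (W -> W)) (r r' s s' : W).
Hypothesis sys : rigid_system F N r r' s s'.
Local Notation X := (blocks W).
Local Notation Pol := (Pol F N).
Local Notation normal_form := (normal_form F N).

Lemma boxP n (c : 'I_n -> option bool) i j (g : W -> W) (x : 'I_n -> X) :
  (forall k, c k <> None -> block_of (x k) = c k) ->
  box c i j g x = if x i is Some (_, w) then Some (j, g w) else None.
Proof.
move=> cx; rewrite /box; case: ifP => // /negP[]; apply/forallP => k.
by case: eqP => //= ck; apply/eqP/cx.
Qed.

Lemma boxN n (c : 'I_n -> option bool) i j (g : W -> W) (x : 'I_n -> X) k :
  c k <> None -> block_of (x k) <> c k -> box c i j g x = None.
Proof.
move=> ck xk; rewrite /box; case: ifP => // /forallP/(_ k).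
by case: eqP => // _; case: eqP.
Qed.

(** If no line is supported on both blocks, a nonzero value at an argument [a]
with fewest nonzero entries gives the box: [f] vanishes outside the box of [a]
by [support_box], and on the box it ignores the variables where [a] is 0.  What
remains is an operation on W with lines in [N], to which [collapse] applies. *)
Lemma Pol_normal_form n (f : operation X n.+1) : Pol f -> normal_form f.
Proof.
move=> Pf.
have [f0|/contrapT f0] := pselect (f (fun=> None) <> None).
  by apply: (@Normal_cst _ _ _ _ _ (f (fun=> None))); exact: (Pol_zero sys Pf f0).
have [[c [k [b [g Fg E]]]]|nofull] := pselect (exists c k b,
    exists2 g, F g & (fun x => f (upd c k x)) =1 full b g).
  by apply: (@Normal_full _ _ _ _ _ k b g Fg); exact: (full_line sys Pf Fg E).
have {}nofull c k b g : F g -> ~ (fun x => f (upd c k x)) =1 full b g.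
  by move=> Fg E; apply: nofull; exists c, k, b, g.
have [fN|/existsNP[a1 fa1]] := pselect (forall a, f a = None).
  exact: (@Normal_cst _ _ _ _ _ None).
pose supp (c : 'I_n.+1 -> X) := #|[pred k | block_of (c k) != None]|.
pose p m := `[< exists2 a, f a <> None & supp a = m >].
have exp : exists m, p m by exists (supp a1); apply/asboolP; exists a1.
case: (ex_minnP exp) => m /asboolP[a fa am] minm.
have mina c : supp c < supp a -> f c = None.
  rewrite am => cm; apply: contrapT => fc.
  by move: cm; rewrite ltnNge minm //; apply/asboolP; exists c.
have boxa := support_box sys Pf nofull fa mina.
pose c k := block_of (a k).
have c0 k : (c k <> None) <-> (a k <> None).
  by rewrite /c; split=> ck E; apply: ck; apply/block_of0.
have [j [w0 Ea]] : exists j w, f a = Some (j, w).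
  by case: (f a) fa => [[j w]|//] _; exists j, w.
pose b' (b : 'I_n.+1 -> X) k := if c k is Some _ then b k else None.
(* on the box the entries outside the support of [a] do not matter *)
have offbox b : (forall k, c k <> None -> block_of (b k) = c k) ->
    f b = f (b' b) /\ block_of (f b) = Some j.
  move=> cb; have tb' : block_of (f (b' b)) = Some j.
    have <- : block_of (f a) = Some j by rewrite Ea.
    apply: (Pol_block_of sys Pf) => k.
    rewrite /b'; case E : (c k) => [i|]; first by rewrite cb ?E.
    by rewrite -/(c k) E.
  suff E : f b = f (b' b) by rewrite E.
  pose P d := f d = f (b' b) /\ forall k, d k = b' b k \/ d k = b k.
  suff [] : P b by [].
  apply: (@upd_ind _ _ P (b' b)); first by split=> // k; left.
  move=> d k [fd db]; split; last first.
    by move=> l; rewrite /upd; case: eqP => [->|_]; [right|exact: db].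
  rewrite -fd.
  have [E|] := pselect (d k = b k); first by rewrite -E upd_id.
  have [E|//] := db k; rewrite E /b'; case ck : (c k) => [//|] _.
  have dk : d k = None by rewrite E /b' ck.
  have := G_nonzero_at0 (Pol_line sys Pf d k).
  rewrite -dk upd_id fd => -> //; rewrite dk.
  by move=> H; move: tb'; rewrite H.
pose tup (v : 'I_n.+1 -> W) k : X := if c k is Some i then Some (i, v k) else None.
have ctup v k : c k <> None -> block_of (tup v k) = c k.
  by rewrite /tup; case: (c k).
pose fbar v := if f (tup v) is Some (_, w) then w else r.
have fE v : f (tup v) = Some (j, fbar v).
  rewrite /fbar; have [_] := offbox _ (ctup v).
  by case: (f _) => [[i w]|] //= -[->].
have Nbar v k : N (fun x => fbar (upd v k x)).
  case ck : (c k) => [i|]; last first.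
    have -> : (fun x => fbar (upd v k x)) = (fun=> fbar v).
      apply/funext => x; have : f (tup (upd v k x)) = f (tup v).
        congr f; apply/funext => l; rewrite /tup /upd.
        by case: eqP => [->|//]; rewrite ck.
      by rewrite !fE => -[].
    exact: (sys_cst sys).
  have E x : f (upd (tup v) k (Some (i, x))) = Some (j, fbar (upd v k x)).
    rewrite -fE; congr f; apply/funext => l; rewrite /tup /upd.
    by case: eqP => [->|//]; rewrite ck.
  case: (Pol_line sys Pf (tup v) k) => [x Ex|b g Fg Eg|i' j' g Ng Eg].
  - have -> : (fun x => fbar (upd v k x)) = (fun=> fbar (upd v k r)).
      by apply/funext => y; have := E y; rewrite Ex -(Ex (Some (i, r))) E => -[].
    exact: (sys_cst sys).
  - by case: (nofull _ _ _ _ Fg Eg).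
  - have -> // : (fun x => fbar (upd v k x)) = g.
    apply/funext => y; have := Eg (Some (i, y)); rewrite E /=.
    by case: eqP => // _ [].
have [i [g Ng Eg]] := collapse (sys_cst sys) (sys_rigid sys) (sys_rr' sys)
  (sys_third sys) Nbar.
have {}Eg b : (forall k, c k <> None -> block_of (b k) = c k) ->
    f b = Some (j, g (if b i is Some (_, w) then w else r)).
  move=> cb; rewrite -(Eg (fun k => if b k is Some (_, w) then w else r)) -fE.
  have [-> _] := offbox _ cb; congr f; apply/funext => k; rewrite /b' /tup.
  case ck : (c k) => [i'|//]; have : block_of (b k) = Some i' by rewrite cb ck.
  by case: (b k) => [[i1 w]|] //= [->].
have fbox i0 g0 : c i0 <> None ->
    (forall b, (forall k, c k <> None -> block_of (b k) = c k) ->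
      f b = if b i0 is Some (_, w) then Some (j, g0 w) else None) ->
    forall b, f b = box c i0 j g0 b.
  move=> ci0 E b; have [cb|/existsNP[k /not_implyP[ck bk]]] :=
    pselect (forall k, c k <> None -> block_of (b k) = c k).
    by rewrite boxP // E.
  rewrite (boxN _ _ _ ck bk); apply: contrapT => fb; apply: bk.
  by apply: boxa => //; apply/c0.
have [ci|ci] := pselect (c i = None); last first.
  apply: (@Normal_box _ _ _ _ f c i j g ci Ng).
  apply: fbox => // b cb; rewrite (Eg _ cb).
  by have := cb i ci; case: (b i) => [[i1 w]|] //= E; case: ci.
(* [collapse] may return a variable without condition; then [g] is constant *)
have [i1 ci1] : exists i1, c i1 <> None.
  apply: contrapT => H; apply: fa; rewrite -f0; congr f; apply/funext => k.
  apply: contrapT => ak; apply: H; exists k; exact/c0.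
apply: (@Normal_box _ _ _ _ f c i1 j (fun=> g r) ci1 (sys_cst sys _)).
apply: fbox => // b cb; rewrite (Eg _ cb).
have -> : g (if b i is Some (_, w) then w else r) = g r.
  have cb' : forall k, c k <> None -> block_of (upd b i None k) = c k.
    by move=> k ck; rewrite /upd; case: eqP => [Ek|_]; [rewrite Ek in ck|exact: cb].
  have [E _] := offbox _ cb; have [E' _] := offbox _ cb'.
  have : f b = f (upd b i None).
    rewrite E E'; congr f; apply/funext => k; rewrite /b'.
    case ck : (c k) => [i2|//]; rewrite updN //; apply/eqP => ki.
    by rewrite ki ci in ck.
  by rewrite (Eg _ cb) (Eg _ cb') updE => -[].
by have := cb i1 ci1; case: (b i1) => [[i2 w]|] //= E; case: ci1.
Qed.

End NormalForms.

(** * The monoidal interval is the lattice of ideals *)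

Section Interval.
Variables (W : Type) (F N : set (W -> W)) (r r' s s' : W).
Hypothesis sys : rigid_system F N r r' s s'.
Local Notation X := (blocks W).
Local Notation G := (unary_monoid F N).
Local Notation Pol := (Pol F N).

Definition ideal (B : set (W -> W)) : Prop :=
  B `<=` N /\
  forall m g, F m \/ N m -> B g -> B (m \o g) /\ B (g \o m).

(** The unary operations that an operation of the clone of [B] may become under
substitutions unless it is essentially unary. *)
Inductive thin (B : set (W -> W)) (h : X -> X) : Prop :=
| Thin_cst c of h =1 (fun=> c)
| Thin_blk i j g of B g & h =1 blk i j g.

Definition ess_unary n (f : operation X n) :=
  exists k, exists u : X -> X, forall a, f a = u (a k).

(** Membership is expressed by substitutions rather than by normal forms, which
makes closure under composition immediate. *)
Definition in_clone (B : set (W -> W)) n (f : operation X n) : Prop :=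
  Pol f /\ (ess_unary f \/
    forall w : 'I_n -> X -> X, (forall k, G (w k)) ->
      thin B (fun x => f (fun k => w k x))).

Definition clone_of (B : set (W -> W)) : set (operations X) :=
  [set o : operations X | in_clone B (projT2 o)].

Lemma ideal_cst B g c : ideal B -> B g -> B (fun=> c).
Proof.
move=> [_ idB] Bg.
have Nc : F (fun=> c) \/ N (fun=> c) by right; exact: (sys_cst sys).
exact: (proj1 (idB _ _ Nc Bg)).
Qed.

Lemma ideal_N : ideal N.
Proof.
split=> // m g [Fm|Nm] Ng; split.
- exact: (sys_FN sys).
- exact: (sys_NF sys).
- exact: (sys_NN sys).
- exact: (sys_NN sys).
Qed.

Lemma thin_G B h : ideal B -> thin B h -> G h.
Proof.
move=> [BN _] [c E|i j g /BN Ng E]; first exact: G_cst E.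
exact: G_blk Ng E.
Qed.

Lemma thin_comp B u h : ideal B -> G u -> thin B h -> thin B (u \o h).
Proof.
move=> iB Gu [c E|i j g Bg E].
  by apply: (@Thin_cst _ _ (u c)) => x /=; rewrite E.
case: Gu => [c Eu|b m Fm Eu|i' j' m Nm Eu].
- by apply: (@Thin_cst _ _ c) => x /=; rewrite Eu.
- have [Bmg _] := iB.2 m g (or_introl Fm) Bg.
  apply: (Thin_blk (i := i) (j := j (+) b) Bmg) => x /=; rewrite Eu E.
  by case: x => [[k v]|] //=; case: eqP.
- have [Bmg _] := iB.2 m g (or_intror Nm) Bg.
  have [ji|ji] := eqVneq j i'.
    apply: (Thin_blk (i := i) (j := j') Bmg) => x /=; rewrite Eu E.
    by case: x => [[k v]|] //=; case: eqP => //= _; rewrite ji eqxx.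
  apply: (@Thin_cst _ _ None) => x /=; rewrite Eu E.
  by case: x => [[k v]|] //=; case: eqP => //= _; rewrite (negbTE ji).
Qed.

Lemma Pol_comp n m (f : operation X n) (g : 'I_n -> operation X m) :
  Pol f -> (forall k, Pol (g k)) -> Pol (comp_op f g).
Proof. by move=> Pf Pg w Gw; apply: Pf => k; exact: Pg. Qed.

Lemma Pol_ess n (f : operation X n) k u :
  G u -> (forall a, f a = u (a k)) -> Pol f.
Proof.
move=> Gu E w Gw; have -> : (fun x => f (fun k => w k x)) = u \o w k.
  by apply/funext => x; rewrite E.
exact: (G_comp sys).
Qed.

Lemma ess_G n (f : operation X n) k u :
  Pol f -> (forall a, f a = u (a k)) -> G u.
Proof.
move=> Pf E; have := Pf (fun=> id) (fun=> G_idfun sys).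
by congr G; apply/funext => x; rewrite E.
Qed.

Lemma clone_of_clone B : ideal B -> is_clone (clone_of B).
Proof.
move=> iB; split.
  move=> n k; split; first exact: (Pol_ess (G_idfun sys) (k := k)).
  by left; exists k, id.
move=> n m f g [/= Pf Cf] Cg; split.
  by apply: Pol_comp => // k; case: (Cg k).
case: Cf => [[k [u fu]]|Tf]; last first.
  by right=> w Gw; apply: Tf => k; case: (Cg k) => Pg _; exact: Pg.
have Gu := ess_G Pf fu.
case: (Cg k) => /= Pg [[l [v gv]]|Tg].
  by left; exists l, (u \o v) => a; rewrite /= /comp_op fu gv.
right=> w Gw; have := thin_comp iB Gu (Tg w Gw).
by congr thin; apply/funext => x; rewrite /comp_op fu.
Qed.

Lemma clone_of_unary B : ideal B -> unary_part (clone_of B) = G.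
Proof.
move=> iB; apply/seteqP; split=> [h [/= Ph _]|h Gh].
  by have := Ph (fun=> id) (fun=> G_idfun sys).
split=> /=; first exact: (Pol_ess Gh (k := ord0)).
by left; exists ord0, h.
Qed.

(** The test operations: [wide g] belongs to a clone exactly if [g] belongs to
the corresponding ideal. *)
Definition wide (g : W -> W) : operation X 2 :=
  box (fun=> Some true) ord0 true g.

Lemma ord2_cases (k : 'I_2) : k = ord0 \/ k = ord_max.
Proof. by case: k => -[|[|//]] ?; [left|right]; apply: val_inj. Qed.

Lemma wideE g (x : 'I_2 -> X) :
  wide g x =
    if (block_of (x ord0) == Some true) && (block_of (x ord_max) == Some true)
    then blk true true g (x ord0) else None.
Proof.
case: ifP => [/andP[/eqP x0 /eqP x1]|].
  rewrite /wide boxP; last by move=> k _; case: (ord2_cases k) => ->.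
  by case: (x ord0) x0 => [[i w]|] //= [->]; rewrite eqxx.
case: eqP => [_ /= /eqP x1|x0 _]; rewrite /wide.
  by apply: (boxN _ _ _ (k := ord_max)).
by apply: (boxN _ _ _ (k := ord0)).
Qed.

Lemma G_block_of_test v : G v ->
  (exists b, forall x, (block_of (v x) == Some true) = b) \/
  (exists i, forall x, (block_of (v x) == Some true) = (block_of x == Some i)).
Proof.
case=> [a E|b m _ E|i j m _ E].
- by left; exists (block_of a == Some true) => x; rewrite E.
- right; exists (~~ b) => x; rewrite E.
  by case: x => [[k y]|] //=; case: k b {E} => [] [].
- case: j E => E; [right; exists i|left; exists false] => x; rewrite E.
    by case: x => [[k y]|] //=; rewrite (inj_eq Some_inj); case: (k == i).
  by case: x => [[k y]|] //=; case: (k == i).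
Qed.

Lemma thin_filter B u v : (forall c, B (fun=> c)) -> thin B u -> G v ->
  thin B (fun x => if block_of (v x) == Some true then u x else None).
Proof.
move=> Bc Tu /G_block_of_test[[[] E]|[i E]].
- by case: Tu => [c Eu|i' j' g Bg Eu]; [apply: (@Thin_cst _ _ c)|
    apply: (Thin_blk Bg (i := i') (j := j'))] => x; rewrite E.
- by apply: (@Thin_cst _ _ None) => x; rewrite E.
have eqS (k l : bool) : (Some k == Some l) = (k == l) by [].
case: Tu => [[[j w]|] Eu|i' j' g Bg Eu].
- apply: (Thin_blk (Bc w) (i := i) (j := j)) => x; rewrite E Eu.
  by case: x => [[k y]|] //=; rewrite eqS.
- by apply: (@Thin_cst _ _ None) => x; rewrite Eu; case: ifP.
have [ii|ii] := eqVneq i' i.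
  apply: (Thin_blk Bg (i := i') (j := j')) => x; rewrite E Eu ii.
  by case: x => [[k y]|] //=; rewrite eqS; case: eqP.
apply: (@Thin_cst _ _ None) => x; rewrite E Eu.
case: x => [[k y]|] //=; rewrite eqS; case: (eqVneq k i) => // ->.
by rewrite eq_sym (negbTE ii).
Qed.

Lemma wide_thin B g : ideal B -> B g -> forall w : 'I_2 -> X -> X,
  (forall k, G (w k)) -> thin B (fun x => wide g (fun k => w k x)).
Proof.
move=> iB Bg w Gw; have Bc c := ideal_cst c iB Bg.
have Tg : thin B (blk true true g \o w ord0).
  have Ng := iB.1 _ Bg.
  case: (Gw ord0) => [c E|b m Fm E|i j m Nm E].
  - by apply: (@Thin_cst _ _ (blk true true g c)) => x /=; rewrite E.
  - have [_ Bgm] := iB.2 m g (or_introl Fm) Bg.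
    apply: (Thin_blk (i := ~~ b) (j := true) Bgm) => x /=; rewrite E.
    by case: x => [[k y]|] //=; case: k b {E} => [] [].
  - have [_ Bgm] := iB.2 m g (or_intror Nm) Bg.
    case: j E => E.
      apply: (Thin_blk (i := i) (j := true) Bgm) => x /=; rewrite E.
      by case: x => [[k y]|] //=; case: (k == i).
    apply: (@Thin_cst _ _ None) => x /=; rewrite E.
    by case: x => [[k y]|] //=; case: (k == i).
have := thin_filter Bc (thin_filter Bc Tg (Gw ord_max)) (Gw ord0).
congr thin; apply/funext => x; rewrite wideE /=.
by case: (block_of (w ord0 x) == _).
Qed.

Lemma clone_of_wide B g : ideal B -> clone_of B (op (wide g)) <-> B g.
Proof.
move=> iB; split=> [[/= Pg [[k [u Eu]]|Tg]]|Bg]; last first.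
  split=> /=; last by right; exact: wide_thin.
  by move=> w Gw; apply: (thin_G iB); exact: wide_thin.
- have := Tg (fun k => if k == ord0 then id else fun=> Some (true, r)).
  have -> : (fun x => wide g (fun k => (if k == ord0 then id
      else fun=> Some (true, r)) x)) = blk true true g.
    apply/funext => x; rewrite wideE /= andbT.
    by case: x => [[i w]|] //=; case: i.
  case=> [k|c E|i j d Bd E].
  + by case: eqP => _; [exact: (G_idfun sys)|exact: G_const].
  + by have := E (Some (true, r)); rewrite -(E None).
  + have -> // : g = d.
    apply/funext => w; have := E (Some (true, w)); rewrite /=.
    by case: eqP => // _ [].
- pose p : X := Some (true, r).
  have := Eu (fun=> p); rewrite wideE /= => E.
  have := Eu (fun l => if l == k then p else None); rewrite eqxx -E wideE.
  case: (eqVneq ord0 k) => [<-|k0] /=; rewrite ?eqxx //=.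
Qed.

Lemma box_thin B n (f : operation X n) c i j g (w : 'I_n -> X -> X) :
  ideal B -> B g -> c i <> None -> (forall a, f a = box c i j g a) ->
  (forall k, G (w k)) -> G (fun x => f (fun k => w k x)) ->
  thin B (fun x => f (fun k => w k x)).
Proof.
move=> iB Bg ci fE Gw Gh.
have fS a : f a <> None -> exists2 v, a i = Some v & f a = Some (j, g v.2).
  rewrite fE /box; case: ifP => // _.
  by case: (a i) => [[k v]|] // _; exists (k, v).
(* on each block where it does not vanish, the substitution acts as [g \o m] *)
have onblock b : (exists v, f (fun k => w k (Some (b, v))) <> None) ->
    exists2 m, F m \/ N m & forall v j' v',
      f (fun k => w k (Some (b, v))) = Some (j', v') -> v' = g (m v).
  move=> [v0 /fS[[j0 u0] wv0 _]].
  suff [m Mm Em] : exists2 m, F m \/ N m &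
      forall v, omap snd (w i (Some (b, v))) = Some (m v).
    exists m => // v j' v' E; have [|[j1 u] wv] := fS (fun k => w k (Some (b, v))).
      by rewrite E.
    by rewrite E => -[_ ->]; have := Em v; rewrite wv /= => -[->].
  case: (Gw i) => [x E|b' m Fm E|i' j' m Nm E].
  - exists (fun=> u0); first by right; exact: (sys_cst sys).
    by move=> v; rewrite E -(E (Some (b, v0))) wv0.
  - by exists m; [left|move=> v; rewrite E].
  - exists m; [by right|move=> v; rewrite E /=].
    by move: wv0; rewrite E /=; case: ifP.
case: Gh => [x E|b d Fd E|i' j' d Nd E].
- exact: Thin_cst E.
- have [|m Mm Em] := onblock true; first by exists r; rewrite E.
  have Ngm : N (g \o m) by have [_ /iB.1] := iB.2 m g Mm Bg.
  case: (FN_disj sys Fd Ngm) => v; apply/esym.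
  by apply: Em; rewrite E.
- have E' v : f (fun k => w k (Some (i', v))) = Some (j', d v).
    by rewrite E /= eqxx.
  have [|m Mm Em] := onblock i'; first by exists r; rewrite E'.
  have Ed : d = g \o m by apply/funext => v; exact: Em (E' v).
  have [_ Bgm] := iB.2 m g Mm Bg; rewrite -Ed in Bgm.
  by apply: (Thin_blk (i := i') (j := j') Bgm).
Qed.

Section Generation.
Variable C : set (operations X).
Hypotheses (clC : is_clone C) (C1 : unary_part C = G).

Lemma clone_unary h : G h -> C (op (unary_op h)).
Proof. by rewrite -C1. Qed.

Lemma clone_Pol n (f : operation X n.+1) : C (op f) -> Pol f.
Proof.
move=> Cf w Gw; rewrite -C1.
exact: (clC.2 _ _ _ (fun k => unary_op (w k)) Cf (fun k => clone_unary (Gw k))).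
Qed.

Lemma clone_ess n (f : operation X n.+1) k u :
  G u -> (forall a, f a = u (a k)) -> C (op f).
Proof.
move=> Gu E; have -> : f = comp_op (unary_op u) (fun=> proj k).
  by apply/funext => a; rewrite E.
by apply: clC.2 => [|_]; [exact: clone_unary|exact: clC.1].
Qed.

Lemma clone_comp2 n (f : operation X 2) (g0 g1 : operation X n.+1) :
  C (op f) -> C (op g0) -> C (op g1) ->
  C (op ((fun a => f (fun k => if k == ord0 then g0 a else g1 a))
    : operation X n.+1)).
Proof.
move=> Cf C0 C1'; have := clC.2 _ _ f (fun k => if k == ord0 then g0 else g1) Cf.
have -> : comp_op f (fun k => if k == ord0 then g0 else g1) =
    (fun a => f (fun k => if k == ord0 then g0 a else g1 a)).
  by apply/funext => a; congr f; apply/funext => k; case: eqP.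
by apply=> k; case: eqP.
Qed.

Definition shift (i j : bool) : X -> X := full (i (+) j) id.

Lemma G_shift i j : G (shift i j).
Proof. exact: G_full (sys_id sys) _. Qed.

Lemma shiftE i j w : shift i j (Some (i, w)) = Some (j, w).
Proof. by case: i j => [] []. Qed.

Lemma block_ofS (x : X) b : block_of x = Some b -> exists v, x = Some (b, v).
Proof. by case: x => [[c v]|] //= [->]; exists v. Qed.

Lemma block_of_shift i j x :
  (block_of (shift i j x) = Some j) <-> (block_of x = Some i).
Proof. by case: x i j => [[[] w]|] [] []. Qed.

(** Constants of the right blocks fulfil the conditions on the variables other
than [i] and [k]; exchanging the blocks where necessary does the rest. *)
Lemma box_wide n (f : operation X n.+1) c i j g k :
  C (op f) -> (forall a, f a = box c i j g a) -> c i <> None ->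
  c k <> None -> k != i -> C (op (wide g)).
Proof.
case ci : (c i) => [bi|//]; case ck : (c k) => [bk|//] Cf fE _ _ ki.
pose h l : operation X 2 := fun x =>
  if l == i then shift true bi (x ord0) else
  if l == k then shift true bk (x ord_max) else
  if c l is Some b then Some (b, r) else None.
have Ch l : C (op (h l)).
  have [E|li] := eqVneq l i.
    apply: (clone_ess (G_shift true bi) (k := ord0)) => x.
    by rewrite /h E eqxx.
  have [E|lk] := eqVneq l k.
    apply: (clone_ess (G_shift true bk) (k := ord_max)) => x.
    by rewrite /h (negbTE li) E eqxx.
  apply: (clone_ess (G_const _ _ (if c l is Some b then Some (b, r) else None))
    (k := ord0)) => x.
  by rewrite /h (negbTE li) (negbTE lk).
have Cfh : C (op (comp_op f h)) by exact: clC.2.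
have -> : wide g = comp_op (unary_op (shift j true)) (fun=> comp_op f h).
  apply/funext => x; rewrite wideE /comp_op /unary_op fE.
  case: ifP => [/andP[/eqP x0 /eqP x1]|].
    rewrite boxP; last first.
      move=> l cl; rewrite /h; have [->|li] := eqVneq l i.
        by rewrite ci; apply/block_of_shift.
      have [->|lk] := eqVneq l k; first by rewrite ck; apply/block_of_shift.
      by case: (c l) cl.
    by rewrite /h eqxx; have [v ->] := block_ofS x0; rewrite !shiftE.
  case: eqP => [x0 /= /eqP x1|x0 _].
    rewrite (boxN _ _ _ (k := k)) ?ck // /h (negbTE ki) eqxx.
    by move=> /block_of_shift.
  by rewrite (boxN _ _ _ (k := i)) ?ci // /h eqxx => /block_of_shift.
by apply: clC.2 => [|_] //; exact: clone_unary (G_shift _ _).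
Qed.

(** [wide (fun=> r)] is a conjunction, by which the conditions on all variables
are collected into a single one. *)
Lemma wide_box n (c : 'I_n.+1 -> option bool) i j g :
  C (op (wide (fun=> r))) -> C (op (wide g)) -> c i <> None ->
  C (op (box c i j g : operation X n.+1)).
Proof.
move=> Cmeet Cg; case ci : (c i) => [b|//] _.
pose ok (a : 'I_n.+1 -> X) k := (c k == None) || (block_of (a k) == c k).
pose test l : operation X n.+1 := fun a =>
  if all (ok a) l then Some (true, r) else None.
have Ctest l : C (op (test l)).
  elim: l => [|k l IH].
    exact: (clone_ess (G_const _ _ (Some (true, r))) (k := ord0)).
  case ck : (c k) => [bk|]; last first.
    have -> // : test (k :: l) = test l.
    by apply/funext => a; rewrite /test /= /ok ck eqxx.
  have Ck : C (op ((fun a => shift bk true (a k)) : operation X n.+1)).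
    exact: (clone_ess (G_shift bk true) (k := k)).
  have := clone_comp2 Cmeet Ck IH; congr (C (op _)); apply/funext => a.
  rewrite wideE /= /test /= /ok ck /=.
  have -> : (block_of (shift bk true (a k)) == Some true) =
      (block_of (a k) == Some bk).
    by apply/eqP/eqP => /block_of_shift.
  case: eqP => //= ak; case: (all _ _) => //=.
  by have [v ->] := block_ofS ak; rewrite shiftE.
have Ci : C (op ((fun a => shift b true (a i)) : operation X n.+1)).
  exact: (clone_ess (G_shift b true) (k := i)).
have Cw := clone_comp2 Cg Ci (Ctest (enum 'I_n.+1)).
have -> : (box c i j g : operation X n.+1) = comp_op (unary_op (shift true j))
    (fun=> (fun a => wide g (fun k => if k == ord0 then shift b true (a i)
                                      else test (enum 'I_n.+1) a))).
  apply/funext => a; rewrite /comp_op /unary_op wideE /= /box /test.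
  have -> : [forall k, (c k == None) || (block_of (a k) == c k)] =
      all (ok a) (enum 'I_n.+1).
    apply/forallP/allP => [H k _|H k]; first exact: H.
    by apply: H; rewrite mem_enum.
  case: ifP => [/allP H|_]; last by rewrite andbF.
  have := H i; rewrite mem_enum => /(_ isT); rewrite /ok ci /= andbT => /eqP ai.
  by have [v ->] := block_ofS ai; rewrite !shiftE /= ?shiftE.
by apply: clC.2 => [|_] //; exact: clone_unary (G_shift _ _).
Qed.

Let B : set (W -> W) := [set g | N g /\ C (op (wide g))].

(** Composing [wide g] on the outside, or in its first variable, with a unary map
that acts by [m] on the first block yields [wide (m \o g)] or [wide (g \o m)]. *)
Lemma wide_ideal : ideal B.
Proof.
have comp_wide h h' g g' : G h -> G h' -> C (op (wide g)) ->
    (forall a, wide g' a =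
       h (wide g (fun k => if k == ord0 then h' (a ord0) else a ord_max))) ->
    C (op (wide g')).
  move=> Gh Gh' Cg /funext->.
  have Ch' := clone_ess (f := fun a : 'I_2 -> X => h' (a ord0)) Gh' (fun=> erefl).
  exact: (clC.2 _ _ (unary_op h) (fun=> _) (clone_unary Gh)
    (fun=> clone_comp2 Cg Ch' (clC.1 1 ord_max))).
split=> [g []//|m g Mm [Ng Cg]].
pose u := if pselect (F m) then full false m else blk true true m.
have Gu : G u.
  rewrite /u; case: pselect => Fm; first exact: G_full Fm _.
  by case: Mm => // Nm; exact: G_blk Nm _.
have u0 : u None = None by rewrite /u; case: pselect.
have uE w : u (Some (true, w)) = Some (true, m w).
  by rewrite /u; case: pselect.
have tu x : block_of (u x) = Some true <-> block_of x = Some true.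
  by rewrite /u; case: (pselect _) => Fm; case: x => [[[] v]|].
split; split.
- by case: Mm => Mm; [exact: (sys_FN sys)|exact: (sys_NN sys)].
- apply: (comp_wide u id g _ Gu (G_idfun sys) Cg) => a; rewrite !wideE /=.
  case: ifP => [/andP[/eqP a0 _]|_]; last exact: esym u0.
  by have [v ->] := block_ofS a0; rewrite /= uE.
- by case: Mm => Mm; [exact: (sys_NF sys)|exact: (sys_NN sys)].
- apply: (comp_wide id u g _ (G_idfun sys) Gu Cg) => a; rewrite !wideE /=.
  have -> : (block_of (u (a ord0)) == Some true) = (block_of (a ord0) == Some true).
    by apply/eqP/eqP => /tu.
  case: ifP => // /andP[/eqP a0 _].
  by have [v ->] := block_ofS a0; rewrite uE.
Qed.

(** By the normal forms, both inclusions only concern boxes with at least two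
conditions, for which they are [box_wide] and [wide_box]. *)
Lemma clone_of_wide_ideal : C = clone_of B.
Proof.
have iB := wide_ideal.
apply/seteqP; split=> -[n f] Cf.
  have Pf := clone_Pol Cf; split=> //=.
  case: (Pol_normal_form sys Pf) => [x E|k b g Fg E|c i j g ci Ng E].
  - by left; exists ord0, (fun=> x).
  - by left; exists k, (full b g).
  have [[k [ck ki]]|nw] := pselect (exists k, c k <> None /\ k != i).
    right=> w Gw; apply: (box_thin iB _ ci E Gw); last exact: Pf.
    by split=> //; exact: (box_wide Cf E ci ck ki).
  left; exists i, (fun x => if block_of x == c i
    then omap (fun p => (j, g p.2)) x else None).
  move=> a; rewrite E; case: ifP => [/eqP ai|/eqP ai]; last exact: (boxN _ _ _ ci).
  rewrite boxP; first by case: (a i) => [[]|].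
  move=> k ck; have [->//|ki] := eqVneq k i.
  by case: nw; exists k.
case: Cf => /= Pf Tf.
have ess k u : (forall a, f a = u (a k)) -> C (op f).
  by move=> E; exact: (clone_ess (ess_G Pf E) E).
case: Tf => [[k [u E]]|Tf]; first exact: ess E.
case: (Pol_normal_form sys Pf) => [x E|k b g Fg E|c i j g ci Ng E].
- exact: (ess ord0 (fun=> x)).
- exact: (ess k (full b g)).
(* constants in all variables but [i] turn the box into a block map of [g] *)
suff Bg : B g.
  rewrite (_ : f = box c i j g); last exact/funext.
  by apply: wide_box => //; [have [] := ideal_cst r iB Bg|have [] := Bg].
pose w k : X -> X := if k == i then id
  else fun=> if c k is Some b then Some (b, r) else None.
have ci' b : c i = Some b -> blk b j g =1 (fun x => f (fun k => w k x)).
  move=> cib x; rewrite E /w; have [xi|xi] := pselect (block_of x = Some b).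
    rewrite boxP ?eqxx; last first.
      by move=> k; case: eqP => [->|_]; [rewrite cib|case: (c k)].
    by have [v ->] := block_ofS xi; rewrite /= eqxx.
  rewrite (boxN _ _ _ ci) ?eqxx ?cib //.
  by case: x xi => [[b1 v]|] //=; case: eqP => // ->.
case: (Tf w).
- by move=> k; rewrite /w; case: eqP => _; [exact: (G_idfun sys)|exact: G_const].
- case cib : (c i) ci => [b|//] _ x Ex.
  have := ci' _ cib None; have := ci' _ cib (Some (b, r)).
  by rewrite !Ex /= eqxx => <-.
- case cib : (c i) ci => [b|//] _ i' j' d Bd Ed.
  have -> // : g = d.
  apply/funext => v; have := ci' _ cib (Some (b, v)).
  by rewrite Ed /= eqxx; case: eqP => // _ [].
Qed.

End Generation.

Lemma unary_monoid_submonoid : is_submonoid G.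
Proof. by split; [exact: (G_idfun sys)|exact: (G_comp sys)]. Qed.

Lemma interval_ideals :
  interval_over G = clone_of @` [set B | ideal B].
Proof.
apply/seteqP; split=> [C [clC C1]|_ [B iB <-]].
  exists [set g | N g /\ C (op (wide g))]; first exact: wide_ideal.
  by rewrite -clone_of_wide_ideal.
by split; [exact: clone_of_clone|exact: clone_of_unary].
Qed.

Lemma clone_of_inj : {in [set B | ideal B] &, injective clone_of}.
Proof.
move=> B B'; rewrite !inE => iB iB' E; apply/seteqP; split=> g Bg.
  by apply/(clone_of_wide g iB'); rewrite -E; apply/(clone_of_wide g iB).
by apply/(clone_of_wide g iB); rewrite E; apply/(clone_of_wide g iB').
Qed.

End Interval.

(** * Words with a prescribed preorder *)

Section Tuples.
Variables (I L : Type) (code : L -> set I) (le : L -> L -> Prop).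
Hypothesis code_inj : injective code.
Hypothesis le_refl : forall p, le p p.
Hypothesis le_trans : forall p q t, le p q -> le q t -> le p t.
Variable i0 : I.

(** The indices [None] and [Some None] are anchors: all words have the letter
[Some true] there, which makes the maps [gam] below rigid.  The letter [None]
stands for an undefined letter. *)
Definition coord : Type := option (option I).
Definition points : Type := (coord + coord * option bool)%type.
Definition word : Type := coord -> option bool.

Definition anchored (u : word) := u None = Some true /\ u (Some None) = Some true.
Definition junk (u : word) := exists z, u z = None.
Definition tup (p : L) : word := fun z =>
  if z is Some (Some i) then Some `[< code p i >] else Some true.

(** The graph of the word [u]; the fixed value on the rest makes the product of
any two such maps constant. *)
Definition gam (u : word) (x : points) : points :=
  if x is inl z then inr (z, u z) else inr (None, None).

Definition rewriting := coord -> option bool -> option bool.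
Definition app (g : rewriting) (u : word) : word := fun z => g z (u z).
Definition act (g : rewriting) (x : points) : points :=
  if x is inr (z, c) then inr (z, g z c) else x.

(** Such rewritings make ideals behave like downsets: junk stays at the bottom,
and an element moves down or becomes junk. *)
Definition decreasing (g : rewriting) :=
  [/\ g None = id, g (Some None) = id, forall u, junk u -> junk (app g u)
    & forall p, junk (app g (tup p)) \/
        exists2 q, le q p & app g (tup p) = tup q].

Local Notation consts := (constants points).
Definition layer (D : set L) : set (points -> points) :=
  [set f | exists2 u, (anchored u /\ junk u) \/ (exists2 p, D p & u = tup p)
                    & f = gam u].
Definition units : set (points -> points) :=
  [set f | exists2 g, decreasing g & f = act g].
Definition nonunits : set (points -> points) := consts `|` layer setT.
Definition downset (D : set L) := forall p q, le q p -> D p -> D q.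

Lemma gam_inj : injective gam.
Proof.
move=> u v /funeqP E; apply/funext => z.
by have := E (inl z) => -[].
Qed.

Lemma gam_neq_const u c : gam u <> (fun=> c).
Proof.
move=> /funeqP E.
have := E (inl None); rewrite -(E (inl (Some None))) /=; discriminate.
Qed.

Lemma anchored_tup p : anchored (tup p). Proof. by []. Qed.

Lemma tup_not_junk p : ~ junk (tup p).
Proof. by case=> -[[i|]|]. Qed.

Lemma tup_inj : injective tup.
Proof.
move=> p q /funeqP E; apply: code_inj; apply/funext => i; apply/propext.
have := E (Some (Some i)) => /= -[] Epq.
by split=> H; apply/asboolP; [rewrite -Epq|rewrite Epq]; apply/asboolP.
Qed.

Lemma act_gam g u : g None = id -> act g \o gam u = gam (app g u).
Proof. by move=> g0; apply/funext => -[z|[z c]] //=; rewrite g0. Qed.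

Lemma gam_act g u : gam u \o act g = gam u.
Proof. by apply/funext => -[z|[z c]]. Qed.

Lemma gam_gam u v : gam u \o gam v = (fun=> inr (None, None)).
Proof. by apply/funext => -[z|[z c]]. Qed.

Lemma app_anchored g u : decreasing g -> anchored u -> anchored (app g u).
Proof. by case=> g0 g1 _ _ [u0 u1]; rewrite /anchored /app g0 g1. Qed.

Lemma layer_act g D f : downset D -> decreasing g -> layer D f ->
  layer D (act g \o f).
Proof.
move=> dD dg [u Du ->]; have [g0 g1 gJ gP] := dg.
rewrite act_gam //; exists (app g u) => //.
case: Du => [[au ju]|[p Dp ->]].
  by left; split; [exact: app_anchored|exact: gJ].
case: (gP p) => [jp|[q qp ->]].
  by left; split=> //; exact: app_anchored.
by right; exists q => //; exact: dD Dp.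
Qed.

Lemma layer_anchored D f : layer D f -> exists2 u, anchored u & f = gam u.
Proof. by case=> u [[au _]|[p _ ->]] ->; [exists u|exists (tup p)]. Qed.

Lemma decreasing_comp g h : decreasing g -> decreasing h ->
  decreasing (fun z => g z \o h z).
Proof.
move=> [g0 g1 gJ gP] [h0 h1 hJ hP]; split.
- by rewrite g0 h0.
- by rewrite g1 h1.
- by move=> u /hJ/gJ.
move=> p; case: (hP p) => [/gJ|[q qp Eq]]; first by left.
have Eg : app (fun z => g z \o h z) (tup p) = app g (tup q).
  by rewrite -Eq.
case: (gP q) => [jq|[t tq Et]]; [left|right]; rewrite Eg //.
by exists t => //; exact: le_trans qp.
Qed.

Lemma tuple_system : rigid_system units nonunits
  (inl None) (inl (Some None)) (inr (None, Some true)) (inr (Some None, Some true)).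
Proof.
have constN c : nonunits (fun=> c) by left; exists c.
split=> //.
- exists (fun _ c => c); last by apply/funext => -[z|[z c]].
  split=> // p; right; exists p => //; exact: le_refl.
- move=> f g [h dh ->] [k dk ->]; exists (fun z => h z \o k z).
    exact: decreasing_comp.
  by apply/funext => -[z|[z c]].
- by move=> f [g _ ->].
- move=> f g [h dh ->] [[c ->]|lg]; first exact: (constN (act h c)).
  by right; exact: layer_act.
- move=> f g [[c ->]|lf] [h dh ->]; first exact: (constN c).
  by have [u au E] := layer_anchored lf; right; rewrite E gam_act -E.
- move=> f g [[c ->]|lf] [[d ->]|lg];
    [exact: constN|exact: (constN c)|exact: (constN (f d))|].
  have [u _ ->] := layer_anchored lf; have [v _ ->] := layer_anchored lg.
  by rewrite gam_gam.
- move=> f [[c ->]|lf]; [by left; exists c|right].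
  have [u [u0 u1] ->] := layer_anchored lf.
  move=> [z|[z c]]; split; split=> //=; try by move=> [->].
  + by move=> [->]; rewrite u0.
  + by move=> [->]; rewrite u1.
- by exists (inr (None, None)).
Qed.

Local Notation ideal := (ideal units nonunits).

Lemma consts_ideal : ideal consts.
Proof.
split=> [f|m g _ [c ->]]; first by left.
by split; [exists (m c)|exists c].
Qed.

Lemma layer_ideal D : downset D -> ideal (consts `|` layer D).
Proof.
move=> dD; split=> [f [cf|[u Du ->]]|m g]; first by left.
  by right; exists u => //; case: Du => [|[p _ ->]]; [left|right; exists p].
have constL c : (consts `|` layer D) (fun=> c) by left; exists c.
move=> Mm [[c ->]|lg]; first by split; [exact: (constL (m c))|exact: (constL c)].
have [u au Eg] := layer_anchored lg.
case: Mm => [[h dh ->]|[[c ->]|lm]].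
- split; first by right; exact: layer_act.
  by right; rewrite Eg gam_act -Eg.
- split; [exact: (constL c)|exact: (constL (g c))].
have [v _ ->] := layer_anchored lm.
by rewrite Eg !gam_gam; split; exact: constL.
Qed.

(** Writing a junk word over whatever is there is a decreasing rewriting, as its
undefined letter makes everything junk.  So all junk words lie in the same
ideals. *)
Definition reset (v : word) : rewriting := fun z c =>
  if z is Some (Some i) then v z else c.

Lemma reset_decreasing v : anchored v -> junk v -> decreasing (reset v).
Proof.
move=> [v0 v1] [z vz].
have J u : junk (app (reset v) u).
  by exists z; rewrite /app /reset; case: z vz => [[i|]|] //; rewrite ?v0 ?v1.
by split=> // [p]; left.
Qed.

Lemma app_reset v u : anchored v -> anchored u -> app (reset v) u = v.
Proof.
move=> [v0 v1] [u0 u1]; apply/funext => -[[i|]|] //=; rewrite /app /=.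
  by rewrite u1 v1.
by rewrite u0 v0.
Qed.

(** Turns the word of [p] into that of [q]; the word of another element differs
from that of [p] somewhere and acquires an undefined letter there. *)
Definition move_tup (p q : L) : rewriting := fun z c =>
  if z is Some (Some i) then if c == tup p z then tup q z else None else c.

Lemma app_move p q : app (move_tup p q) (tup p) = tup q.
Proof. by apply/funext => -[[i|]|] //; rewrite /app /move_tup eqxx. Qed.

Lemma move_decreasing p q : le q p -> decreasing (move_tup p q).
Proof.
move=> qp; split=> // [u [z uz]|t].
  exists z; rewrite /app /move_tup uz.
  by case: z {uz} => [[i|]|].
have [->|tp] := pselect (t = p); first by right; exists q; rewrite ?app_move.
left; apply: contrapT => nj; apply: tp; apply: tup_inj; apply/funext => -[[i|]|] //.
apply: contrapT => ti; apply: nj; exists (Some (Some i)).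
by rewrite /app /move_tup; case: eqP.
Qed.

(** An ideal containing a non-constant map contains all junk by [reset], and it
is closed downwards on the words of elements by [move_tup]. *)
Lemma ideal_trichotomy B : ideal B ->
  [\/ B = set0, B = consts | exists2 D, downset D & B = consts `|` layer D].
Proof.
move=> iB; have [BN idB] := iB.
have [->|/set0P[f Bf]] := eqVneq B set0; first by constructor 1.
have cB : consts `<=` B by move=> _ [c ->]; exact: (ideal_cst tuple_system c iB Bf).
have unit_act g u : decreasing g -> B (gam u) -> B (gam (app g u)).
  move=> dg Bu; have [g0 _ _ _] := dg; rewrite -act_gam //.
  by apply: (proj1 (idB _ _ _ Bu)); left; exists g.
have [Bc|/existsNP[h /not_implyP[Bh hc]]] := pselect (B `<=` consts).
  by constructor 2; apply/seteqP.
have [u au Eh] : exists2 u, anchored u & h = gam u.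
  by case: (BN _ Bh) => [//|/layer_anchored].
constructor 3; exists [set p | B (gam (tup p))].
  move=> p q qp Bp; rewrite /= -(app_move p q).
  by apply: unit_act Bp; exact: move_decreasing.
apply/seteqP; split=> [k Bk|k [/cB//|[v [[av jv]|[p Bp ->]] -> //]]].
  case: (BN _ Bk) => [|[v [[av jv]|[p _ Ev]] Ek]]; first by left.
    by right; exists v => //; left.
  by right; exists v => //; right; exists p; rewrite //= -Ev -Ek.
rewrite -(app_reset av au) -/(gam _); apply: unit_act; last by rewrite -Eh.
exact: reset_decreasing.
Qed.

Variables (T : Type) (dn : T -> set L).
Hypotheses (dn_inj : injective dn)
  (dnP : forall D, downset D <-> exists t, dn t = D).

Definition ideal_of (x : option (option T)) : set (points -> points) :=
  match x with
  | None => set0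
  | Some None => consts
  | Some (Some t) => consts `|` layer (dn t)
  end.

Lemma layer_sub D D' : consts `|` layer D `<=` consts `|` layer D' -> D `<=` D'.
Proof.
move=> DD' p Dp; have [|[c E]|[u Du E]] := DD' (gam (tup p)).
- by right; exists (tup p) => //; right; exists p.
- by case: (gam_neq_const E).
- have {}E := gam_inj E; case: Du => [[_]|[q Dq]]; rewrite -E.
    by move/tup_not_junk.
  by move/tup_inj ->.
Qed.

Lemma ideal_of_inj : injective ideal_of.
Proof.
have c0 : consts (fun=> inr (None, None)) by exists (inr (None, None)).
have nl D : ~ layer D `<=` consts.
  pose u : word := fun z => if z is Some (Some _) then None else Some true.
  move=> H; have [|c E] := H (gam u); last by case: (gam_neq_const E).
  exists u => //; left; split=> //.
  by exists (Some (Some i0)).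
have n0 A : consts `|` A <> set0.
  by move/seteqP => [/(_ (fun=> inr (None, None)))H _]; apply: H; left.
case=> [[t|]|] [[t'|]|] //= E.
- by congr (Some (Some _)); apply: dn_inj; apply/seteqP; split;
    apply: layer_sub; rewrite E.
- by case: (nl (dn t)); rewrite -E; right.
- by case: (n0 _ E).
- by case: (nl (dn t')); rewrite E; right.
- by move: c0; rewrite E.
- by case: (n0 _ (esym E)).
- by move: c0; rewrite -E.
Qed.

Lemma ideal_of_range : range ideal_of = [set B | ideal B].
Proof.
apply/seteqP; split=> [_ [[[t|]|] _ <-]|B /ideal_trichotomy[->|->|[D dD ->]]].
- by apply: layer_ideal; apply/dnP; exists t.
- exact: consts_ideal.
- by split.
- by exists None.
- by exists (Some None).
- by have /dnP[t <-] := dD; exists (Some (Some t)).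
Qed.

End Tuples.

(** * Cardinal arithmetic *)

Lemma card_le_injP T U :
  ([set: T] #<= [set: U]) <-> exists f : T -> U, injective f.
Proof.
split=> [/card_leP[f]|[f fI]].
  exists (\val \o f \o to_setT) => x y /= /val_inj.
  by move=> /(@inj _ _ setT)-/(_ (mem_set I) (mem_set I))[].
rewrite -(card_le_eql (inj_card_eq (f := f) (A := setT) _)); last first.
  by move=> x y _ _ /fI.
exact: card_leT.
Qed.

Lemma card_range T U (f : T -> U) : injective f -> range f #= [set: T].
Proof. by move=> fI; apply: inj_card_eq => x y _ _ /fI. Qed.

Lemma card_bij T U (f : T -> U) (g : U -> T) :
  cancel f g -> cancel g f -> [set: T] #= [set: U].
Proof.
move=> fK gK; rewrite -(_ : range f = setT).
  by rewrite card_eq_sym; apply: card_range; exact: can_inj fK.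
by apply/seteqP; split=> // y _; exists (g y).
Qed.

Lemma card_eq_bij T U : [set: T] #= [set: U] ->
  exists f : T -> U, exists2 g : U -> T, cancel f g & cancel g f.
Proof.
move=> /card_bijP[f [g fK gK]].
have toK V (y : [set: V]) : to_setT (\val y) = y by exact: val_inj.
by exists (\val \o f \o to_setT); exists (\val \o g \o to_setT) => x /=;
  rewrite toK ?fK ?gK.
Qed.

Lemma infinite_sequence T :
  infinite_set [set: T] <-> exists f : nat -> T, injective f.
Proof. by rewrite infiniteP card_le_injP. Qed.

(** A maximal family of injective sequences with disjoint ranges leaves only
finitely many points uncovered.  So every point is coded by a member of the
family and a natural number (the left summand of [nat + nat] for the covered
points, the right one for the others), and the position in a member of the
family can absorb another natural number. *)
Lemma infinite_absorbs_nat T : infinite_set [set: T] ->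
  exists f : T * nat -> T, injective f.
Proof.
move=> Tinf.
pose disj (S : set (nat -> T)) := forall f g m n, S f -> S g ->
  f m = g n -> f = g /\ m = n.
have [S [dS maxS]] : exists S, disj S /\ forall S', S `<` S' -> ~ disj S'.
  apply: Zorn_bigcup => FS Fd Ftot f g m n [S FS1 Sf] [S' FS2 S'g].
  have [SS|SS] := Ftot _ _ FS1 FS2.
    by apply: (Fd _ FS2) => //; exact: SS.
  by apply: (Fd _ FS1) => //; exact: SS.
pose R : set T := [set x | forall f n, S f -> f n <> x].
have Rfin : finite_set R.
  apply: contrapT => /infiniteP; rewrite -(card_le_eqr (card_setT R)).
  move=> /card_le_injP[h hI].
  pose h' n := \val (h n).
  have h'R n : R (h' n) by exact: set_valP.
  have h'I : injective h' by move=> m n /val_inj/hI.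
  apply: (maxS (S `|` [set h'])).
    split; first by left.
    move=> /(_ h' (or_intror erefl)) Sh.
    exact: (h'R 0 h' 0 Sh).
  move=> f g m n [Sf|->] [Sg|->] E.
  - exact: dS.
  - by case: (h'R n f m).
  - by case: (h'R m g n).
  - by split=> //; exact: h'I.
have [f0 Sf0] : exists f0, S f0.
  apply: contrapT => S0; apply: Tinf; apply: sub_finite_set Rfin => x _ f n Sf.
  by case: S0; exists f.
have /card_le_injP[c cI] : [set: R] #<= [set: nat].
  by rewrite (card_le_eql (card_setT R)); exact: finite_set_countable.
have enc x : exists y : (nat -> T) * (nat + nat), S y.1 /\
    match y.2 with inl n => y.1 n = x
                 | inr n => exists2 z : R, \val z = x & c z = n end.
  have [Rx|/existsNP[f /existsNP[n /not_implyP[Sf /contrapT fx]]]] := pselect (R x).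
    exists (f0, inr (c (SigSub (mem_set Rx)))).
    by split=> //=; exists (SigSub (mem_set Rx)).
  by exists (f, inl n).
have [e eP] := choice enc.
have eI : injective e.
  move=> x y exy; have [_] := eP x; have [_] := eP y; rewrite exy.
  case: (e y).2 => n; first by move=> Ey Ex; exact: etrans (esym Ex) Ey.
  move=> [z zy zn] [z' z'x z'n]; rewrite -zy -z'x; congr (\val _).
  by apply: cI; rewrite zn z'n.
exists (fun p => (e p.1).1 (pickle ((e p.1).2, p.2))) => -[x m] [y n] /= E.
have [E1 /(pcan_inj pickleK)[E2 ->]] := dS _ _ _ _ (eP x).1 (eP y).1 E.
congr (_, _); apply: eI.
by case: (e x) (e y) E1 E2 => [? ?] [? ?] /= -> ->.
Qed.

(** * Transport along bijections *)

Section Transport.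
Variables (X Y : Type) (phi : X -> Y) (psi : Y -> X).
Hypotheses (phiK : cancel phi psi) (psiK : cancel psi phi).

Definition push n (f : operation X n) : operation Y n :=
  fun y => phi (f (psi \o y)).

Definition pull (C : set (operations Y)) : set (operations X) :=
  [set o : operations X | C (op (push (projT2 o)))].

Lemma pull_clone C : is_clone C -> is_clone (pull C).
Proof.
move=> [Cproj Ccomp]; split=> [n k|n m f g Cf Cg].
  rewrite /pull /= (_ : push _ = @proj _ n.+1 k); first exact: Cproj.
  by apply/funext => y; rewrite /push /proj /= psiK.
rewrite /pull /= (_ : push _ = comp_op (push f) (fun i => push (g i))).
  exact: Ccomp.
apply/funext => y; rewrite /push /comp_op; congr (phi (f _)).
by apply/funext => i /=; rewrite phiK.
Qed.

Lemma pull_unary C :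
  unary_part (pull C) = [set h | unary_part C (phi \o h \o psi)].
Proof. by []. Qed.

End Transport.

Lemma pullK X Y (phi : X -> Y) (psi : Y -> X) (phiK : cancel phi psi) C :
  pull phi psi (pull psi phi C) = C.
Proof.
apply/seteqP; split=> -[n f]; rewrite /pull /=;
  suff -> : push psi phi (push phi psi f) = f by [].
all: apply/funext => x; rewrite /push phiK; congr f.
all: by apply/funext => k /=; rewrite phiK.
Qed.

Lemma interval_transport X Y V (A : set V) : [set: X] #= [set: Y] ->
  (exists2 J : set (set (operations Y)), is_monoidal_interval J & J #= A) ->
  exists2 J : set (set (operations X)), is_monoidal_interval J & J #= A.
Proof.
move=> /card_eq_bij[phi [psi phiK psiK]] [_ [G [Gid Gcomp] ->] JA].
pose G' : set (X -> X) := [set h | G (phi \o h \o psi)].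
exists (interval_over G').
  exists G' => //; split=> [|f g Gf Gg]; rewrite /G' /=.
    by rewrite (_ : _ \o _ = id) //; apply/funext => y /=; rewrite psiK.
  rewrite (_ : _ \o _ = (phi \o f \o psi) \o (phi \o g \o psi)); first exact: Gcomp.
  by apply/funext => y /=; rewrite phiK.
have <- : pull phi psi @` interval_over G = interval_over G'.
  apply/seteqP; split=> [_ [C [clC CG] <-]|C [clC CG]].
    by split; [exact: pull_clone|rewrite pull_unary CG].
  exists (pull psi phi C); last exact: pullK.
  split; first exact: pull_clone.
  rewrite pull_unary CG; apply/seteqP; split=> h; rewrite /G' /=.
    rewrite (_ : _ \o _ = h) //; apply/funext => y /=; by rewrite !psiK.
  move=> Gh; rewrite (_ : _ \o _ = h) //.
  by apply/funext => y /=; rewrite !psiK.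
rewrite (card_eql (inj_card_eq _)) // => C C' _ _ E.
by rewrite -(pullK psiK C) E pullK.
Qed.

(** Every element of the right-hand side carries at most one element of X and a
finite amount of information. *)
Lemma card_blocks_points X : infinite_set [set: X] ->
  [set: X] #= [set: blocks (points X)].
Proof.
move=> Xinf; apply/card_eqPle; split; apply/card_le_injP.
  by exists (fun x => Some (true, inl (Some (Some x)))) => x y [].
have [f fI] := infinite_absorbs_nat Xinf.
have /infinite_sequence[a _] := Xinf.
pose cd (z : coord X) : X * nat := match z with
  | None => (a 0, 0) | Some None => (a 0, 1) | Some (Some x) => (x, 2) end.
have cdI : injective cd by move=> [[x|]|] [[y|]|] //= [->].
pose pd (w : points X) : X * nat := match w with
  | inl z => ((cd z).1, pickle ((cd z).2, None : option (option bool)))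
  | inr (z, c) => ((cd z).1, pickle ((cd z).2, Some c)) end.
have pdI : injective pd.
  move=> [z|[z c]] [z'|[z' c']] [E1 /(pcan_inj pickleK)]//.
    by case=> E2; congr inl; apply: cdI;
      case: (cd z) (cd z') E1 E2 => [? ?] [? ?] /= -> ->.
  by case=> E2 ->; congr (inr (_, _)); apply: cdI;
    case: (cd z) (cd z') E1 E2 => [? ?] [? ?] /= -> ->.
pose bd (b : blocks (points X)) : X * nat := match b with
  | None => (a 0, pickle (None : option (bool * nat)))
  | Some (i, w) => ((pd w).1, pickle (Some (i, (pd w).2))) end.
exists (f \o bd) => x y /fI.
case: x y => [[i w]|] [[j v]|] //= [E1 /(pcan_inj pickleK)]//.
case=> -> E2; congr (Some (_, _)); apply: pdI.
by case: (pd w) (pd v) E1 E2 => [? ?] [? ?] /= -> ->.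
Qed.

(** * Monoidal intervals of prescribed cardinality *)

(** [T] parametrises the downsets; the two further elements of the interval come
from the empty ideal and from the ideal of constants. *)
Lemma downset_interval X L T (le : L -> L -> Prop) (dn : T -> set L) :
  infinite_set [set: X] -> [set: L] #<= [set: set X] ->
  (forall p, le p p) -> (forall p q t, le p q -> le q t -> le p t) ->
  injective dn -> (forall D, downset le D <-> exists t, dn t = D) ->
  exists2 J : set (set (operations X)),
    is_monoidal_interval J & J #= [set: option (option T)].
Proof.
move=> Xinf /card_le_injP[code codeI] lexx le_tr dnI dnP.
apply: (interval_transport (card_blocks_points Xinf)).
have sys := tuple_system code lexx le_tr.
have /infinite_sequence[a _] := Xinf.
pose e := clone_of (units code le) (nonunits code) \o ideal_of code dn.
have idE x : ideal (units code le) (nonunits code) (ideal_of code dn x).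
  suff : [set B | ideal (units code le) (nonunits code) B]
    (ideal_of code dn x) by [].
  by rewrite -(ideal_of_range codeI lexx le_tr dnP); exists x.
exists (interval_over (unary_monoid (units code le) (nonunits code))).
  exists (unary_monoid (units code le) (nonunits code)) => //.
  exact: (unary_monoid_submonoid sys).
rewrite (interval_ideals sys) -(ideal_of_range codeI lexx le_tr dnP) image_comp.
apply: card_range => x y; rewrite /e /= => /(clone_of_inj sys).
by rewrite !inE => /(_ (idE x) (idE y)); exact: (ideal_of_inj codeI (a 0) dnI).
Qed.

(** Constants generate each other, so without other non-units there are only two
ideals. *)
Section Trivial.
Variables (W : Type) (r r' t : W).
Hypotheses (rr' : r <> r') (tr : t <> r) (tr' : t <> r').

Lemma trivial_system :
  rigid_system [set id] (constants W) r r' t t.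
Proof.
split=> //.
- by move=> f g -> ->.
- by move=> f ->.
- by move=> c; exists c.
- by move=> f g _ [c ->]; exists (f c).
- by move=> f g [c ->] _; exists c.
- by move=> f g [c ->] _; exists c.
- by move=> f [c ->]; left; exists c.
- by exists t.
Qed.

Lemma trivial_ideals :
  [set B | ideal [set id] (constants W) B] =
  [set set0; constants W].
Proof.
apply/seteqP; split=> [B iB|B [|] ->].
- have [->|/set0P[f Bf]] := eqVneq B set0; first by left.
  right; apply/seteqP; split; first exact: iB.1.
  by move=> _ [c ->]; exact: (ideal_cst trivial_system c iB Bf).
- by split.
- exact: (ideal_N trivial_system).
Qed.

Lemma trivial_interval :
  exists2 J : set (set (operations (blocks W))),
    is_monoidal_interval J & J #= [set: bool].
Proof.
pose F : set (W -> W) := [set id].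
pose N := constants W.
exists (interval_over (unary_monoid F N)).
  exists (unary_monoid F N) => //; exact: (unary_monoid_submonoid trivial_system).
rewrite (interval_ideals trivial_system) trivial_ideals.
have -> : [set set0; N] = range (fun b : bool => if b then N else set0).
  apply/seteqP; split=> [B [->|->]|_ [[] _ <-]];
    by [exists false|exists true|right|left].
rewrite image_comp; apply: card_range => b b' /= E.
have NN0 : N <> set0 by move=> /seteqP[/(_ (fun=> r))H _]; apply: H; exists r.
have iB b0 : (if b0 then N else set0) \in [set B | ideal F N B].
  by rewrite inE; case: b0; [exact: (ideal_N trivial_system)|split].
have := clone_of_inj trivial_system (iB b) (iB b') E.
by case: b b' {E} => [] [] // /esym.
Qed.

End Trivial.

(** The monoid of the identity and the constants: its elements are constant or
rigid with [s = r] and [s' = r'], so all operations with lines in it are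
essentially unary. *)
Section Singleton.
Variables (X : Type) (r r' t : X).
Hypotheses (rr' : r <> r') (tr : t <> r) (tr' : t <> r').
Let G : set (X -> X) := [set f | f = id \/ exists c, f = (fun=> c)].

Let G_submonoid : is_submonoid G.
Proof.
split; first by left.
by move=> f g [-> //|[c ->] _]; right; exists c.
Qed.

Let essential : set (operations X) :=
  [set o : operations X |
    exists k, exists2 u, G u & forall a, projT2 o a = u (a k)].

Lemma collapsing_interval :
  exists2 J : set (set (operations X)),
    is_monoidal_interval J & J #= [set: unit].
Proof.
exists (interval_over G); first by exists G.
suff -> : interval_over G = [set essential].
  rewrite -(_ : range (fun _ : unit => essential) = [set essential]).
    by apply: card_range => -[] [].
  by apply/seteqP; split=> [_ [? _ <-]|_ ->] //; exists tt.
have [Gid Gcomp] := G_submonoid.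
have clE : is_clone essential.
  split=> [n k|n m f g [k [u Gu fu]] Cg]; first by exists k, id.
  have [l [v Gv gv]] := Cg k; exists l, (u \o v); first exact: Gcomp.
  by move=> a; exact: etrans (fu (fun i => g i a)) (congr1 u (gv a)).
have unE : unary_part essential = G.
  apply/seteqP; split=> [h [k [u Gu hu]]|h Gh]; last by exists ord0, h.
  suff -> : h = u by [].
  by apply/funext => x; exact: (hu (fun=> x)).
apply/seteqP; split=> [C [clC CG]|_ -> //].
have C1 u : G u -> C (op (unary_op u)) by rewrite -CG.
apply/seteqP; split=> -[n f]; last first.
  move=> [k [u Gu fu]].
  have -> : f = comp_op (unary_op u) (fun=> proj k).
    by apply/funext => a; exact: fu.
  by apply: clC.2 => [|_]; [exact: C1|exact: clC.1].
move=> Cf; apply: (@collapse _ G r r' r r' _ _ rr') => //.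
- by move=> c; right; exists c.
- by move=> g [->|[c ->]]; [right|left; exists c].
- by exists t.
move=> a k; rewrite -CG; change (C (op (unary_op (fun x => f (upd a k x))))).
have := clC.2 _ _ f (fun j => unary_op (if j == k then id else fun=> a j)) Cf.
set h := comp_op _ _; set h' := unary_op _; suff -> : h = h'.
  by apply=> j; apply: C1; case: eqP => _; [left|right; exists (a j)].
apply/funext => x; rewrite /h /h' /comp_op /unary_op; congr f.
by apply/funext => j; rewrite /upd; case: eqP.
Qed.

End Singleton.

Lemma infinite_three X : infinite_set [set: X] ->
  exists x y z : X, [/\ x <> y, z <> x & z <> y].
Proof.
move=> /infinite_sequence[f fI]; exists (f 0), (f 1), (f 2).
by split=> /fI.
Qed.

(** The proper downsets of a well-order are the initial segments below a point,
namely below the least element of the complement. *)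
Lemma well_order_segments L : exists le : L -> L -> Prop,
  exists dn : option L -> set L,
  [/\ forall p, le p p, forall p q t, le p q -> le q t -> le p t,
      injective dn & forall D, downset le D <-> exists t, dn t = D].
Proof.
elim/Peq : L => L; have [R wo] := well_ordering_principle L.
have tot x y : R x y \/ R y x.
  have [|m [[]]] := wo [pred z | (z == x) || (z == y)].
    by exists x; rewrite inE eqxx.
  rewrite inE => /orP[]/eqP -> lb _; [left|right]; apply: lb;
    by rewrite inE eqxx ?orbT.
have refl x : R x x by case: (tot x x).
have anti x y : R x y -> R y x -> x = y.
  move=> xy yx; have [|m [_ mu]] := wo [pred z | (z == x) || (z == y)].
    by exists x; rewrite inE eqxx.
  rewrite -(mu x) ?(mu y) //; split; rewrite ?inE ?eqxx ?orbT //;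
    by move=> z; rewrite inE => /orP[]/eqP ->.
have trans x y z : R x y -> R y z -> R x z.
  move=> xy yz; have [|m [[]]] := wo [pred u | [|| u == x, u == y | u == z]].
    by exists x; rewrite inE eqxx.
  rewrite inE => /or3P[]/eqP -> lb _.
  - by apply: lb; rewrite inE eqxx ?orbT.
  - by rewrite (anti x y) //; apply: lb; rewrite inE eqxx ?orbT.
  - by rewrite -(anti y z) //; apply: lb; rewrite inE eqxx ?orbT.
pose dn (o : option L) : set L :=
  if o is Some p then [set q | R q p /\ q <> p] else setT.
exists R, dn; split=> //.
- move=> [p|] [q|] //= E.
  + congr Some; apply: contrapT => pq.
    have [pq'|qp] := tot p q.
      by have : [set x | R x q /\ x <> q] p by []; rewrite -E => -[_ /(_ erefl)].
    have : [set x | R x p /\ x <> p] q by split=> // qp'; apply: pq.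
    by rewrite E => -[_ /(_ erefl)].
  + by have : [set: L] p by []; rewrite -E => -[_ /(_ erefl)].
  + by have : [set: L] q by []; rewrite E => -[_ /(_ erefl)].
move=> D; split=> [dD|[[p|] <-] x y //= yx [xp xNp]]; last first.
  split; first exact: trans yx xp.
  by move=> yp; apply: xNp; apply: anti => //; rewrite -yp.
have [DT|/existsNP[y Dy]] := pselect (forall x, D x).
  by exists None; apply/esym/seteqP; split.
have [|p [[/asboolP Dp lb] _]] := wo [pred z | `[< ~ D z >]].
  by exists y; apply/asboolP.
exists (Some p); apply/seteqP; split=> q /=.
  move=> [qp qNp]; apply: contrapT => Dq; apply: qNp; apply: anti => //.
  by apply: lb; apply/asboolP.
move=> Dq; split; last by move=> qp; apply: Dp; rewrite -qp.
by case: (tot q p) => // pq; case: Dp; exact: dD Dq.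
Qed.

Lemma card_le_set T U : [set: T] #<= [set: U] -> [set: set T] #<= [set: set U].
Proof.
move=> /card_le_injP[f fI]; apply/card_le_injP; exists (fun A => f @` A).
move=> A B E; apply/seteqP; split=> x xA.
  have : (f @` A) (f x) by exists x.
  by rewrite E => -[y By /fI <-].
have : (f @` B) (f x) by exists x.
by rewrite -E => -[y By /fI <-].
Qed.

Lemma card_option2 T :
  infinite_set [set: T] -> [set: option (option T)] #= [set: T].
Proof.
move=> Tinf; apply/card_eqPle; split; apply/card_le_injP; last first.
  by exists (Some \o Some) => x y [].
have [f fI] := infinite_absorbs_nat Tinf.
have /infinite_sequence[a _] := Tinf.
exists (fun o => f (match o with
  | None => (a 0, 0) | Some None => (a 0, 1) | Some (Some x) => (x, 2) end)).
by move=> [[x|]|] [[y|]|] // /fI// [->].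
Qed.

Lemma remove_three L (a b c : L) : b <> a -> c <> a -> c <> b ->
  [set: option (option (option {x : L | [/\ x <> a, x <> b & x <> c]}))] #=
  [set: L].
Proof.
move=> ba ca cb.
pose L' := {x : L | [/\ x <> a, x <> b & x <> c]}.
pose dec (o : option (option (option L'))) : L :=
  match o with
  | None => a | Some None => b | Some (Some None) => c
  | Some (Some (Some x)) => sval x end.
have decI : injective dec.
  move=> [[[[x [xa xb xc]]|]|]|] [[[[y [ya yb yc]]|]|]|] //= E;
    by [congr (Some (Some (Some _))); exact: eq_exist|case: ba|case: ca|case: cb
       |case: xa|case: xb|case: xc|case: ya|case: yb|case: yc].
rewrite card_eq_sym -(_ : range dec = setT); first exact: card_range.
apply/seteqP; split=> // x _.
have [->|xa] := pselect (x = a); first by exists None.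
have [->|xb] := pselect (x = b); first by exists (Some None).
have [->|xc] := pselect (x = c); first by exists (Some (Some None)).
by exists (Some (Some (Some (exist _ x (And3 xa xb xc))))).
Qed.

Theorem interval_of_cardinality (X : Type) (hX : infinite_set [set: X])
    (L : Type) :
  [set: unit] #<= [set: L] -> [set: L] #<= [set: set X] ->
  exists2 J : set (set (operations X)), is_monoidal_interval J & J #= [set: L].
Proof.
move=> /card_le_injP[u _] LX; pose a := u tt.
have [La|/existsNP[b ba]] := pselect (forall x, x = a).
  have [x [y [z [xy zx zy]]]] := infinite_three hX.
  have [J JI Jc] := collapsing_interval xy zx zy.
  exists J => //; apply: card_eq_trans Jc _.
  apply: (@card_bij _ _ u (fun=> tt)) => [[] //|c]; exact: esym (La c).
have [Lab|/existsNP[c /not_orP[ca cb]]] := pselect (forall x, x = a \/ x = b).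
  have [x [y [z [xy zx zy]]]] := infinite_three hX.
  pose i x : points X := inl (Some (Some x)).
  have iI : injective i by move=> ? ? [].
  have [|||J JI Jc] := @trivial_interval (points X) (i x) (i y) (i z).
  - by move=> /iI.
  - by move=> /iI.
  - by move=> /iI.
  apply: (interval_transport (card_blocks_points hX)).
  exists J => //; apply: card_eq_trans Jc _.
  rewrite -(_ : range (fun b0 : bool => if b0 then a else b) = [set: L]).
    rewrite card_eq_sym; apply: card_range => -[] [] // E; case: ba => //.
  apply/seteqP; split=> // d _.
  by case: (Lab d) => ->; [exists true|exists false].
pose L' := {x : L | [/\ x <> a, x <> b & x <> c]}.
have [le [dn [lexx le_tr dnI dnP]]] := well_order_segments L'.
have L'X : [set: L'] #<= [set: set X].
  apply: card_le_trans LX; apply/card_le_injP; exists sval => -[x px] [y py] /= E.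
  exact: eq_exist.
have [J JI Jc] := downset_interval hX L'X lexx le_tr dnI dnP.
by exists J => //; apply: card_eq_trans Jc (remove_three ba ca cb).
Qed.

Theorem corollary7 (X : Type) (hX : infinite_set [set: X]) :
  (forall L : Type,
     [set: unit] #<= [set: L] -> [set: L] #<= [set: set X] ->
     exists2 I : set (set (operations X)),
       is_monoidal_interval I & I #= [set: L]) /\
  (forall L : Type,
     [set: L] #<= [set: set X] ->
     exists2 I : set (set (operations X)),
       is_monoidal_interval I & I #= [set: set L]).
Proof.
split=> [L|L LX]; first exact: interval_of_cardinality.
have [Lfin|Linf] := pselect (finite_set [set: L]).
  (* [L] embeds into [X], so the first part applies to [set L] *)
  apply: interval_of_cardinality => //.
    by apply/card_le_injP; exists (fun=> set0) => -[] [].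
  apply: card_le_set; apply: card_le_trans (finite_set_countable Lfin) _.
  exact/infiniteP.
have SLinf : infinite_set [set: set L].
  move: Linf; rewrite !infiniteP => H; apply: card_le_trans H _.
  by apply/card_le_injP; exists set1 => x y /seteqP[/(_ x erefl)].
(* for the preorder [eq] every subset is a downset *)
have [|||J JI Jc] := @downset_interval X L (set L) eq id hX LX (@erefl L).
- by move=> p q t -> ->.
- by [].
- by move=> D; split=> [_|_ p q ->//]; exists D.
by exists J => //; apply: card_eq_trans Jc (card_option2 SLinf).
Qed.
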